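(* Let $A$ be a standard graded Koszul $K$-algebra. Let $I$ be an ideal of $A$ generated by a regular sequence $f_1,f_2,\dots,f_k$ of homogeneous forms of degree $d$. Then $K[(I^e)_{ed+c}]$ is Koszul for all integers $c \geq \frac{d(k-1)}{k}$ and $e>0$.
   Context: A standard graded $K$-algebra is a quotient of a polynomial ring over a field $K$ (standard grading) by a homogeneous ideal; it is Koszul if $K=A/A_+$ has a linear free resolution over $A$. $K[(I^e)_{ed+c}]$ denotes the $K$-subalgebra of $A$ generated by the homogeneous elements of degree $ed+c$ of $I^e$, graded so that these generators have degree $1$. *)

(* Defs.v *)
From mathcomp Require Import all_boot all_algebra.
From mathcomp Require Import mpoly.

Set Implicit Arguments.
Unset Strict Implicit.
Unset Printing Implicit Defensive.

Import GRing.Theory.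
Local Open Scope ring_scope.

(* A standard graded K-algebra A = K[x_1..x_n]/J is represented by the
   polynomial ring {mpoly K[n]} together with the (Prop-valued) predicate J
   describing the homogeneous ideal.  Elements of A (and of free A-modules)
   are represented by polynomials (rows of polynomials) modulo J. *)

Section Defs.
Variables (K : fieldType) (n : nat).
Local Notation P := {mpoly K[n]}.

Definition is_ideal (J : P -> Prop) : Prop :=
  [/\ J 0,
      (forall p q, J p -> J q -> J (p + q)) &
      (forall r p, J p -> J (r * p))].

Definition homogeneous_ideal (J : P -> Prop) : Prop :=
  forall p, J p -> forall t : nat, J (pihomog mdeg t p).

(* K[x_1..x_n]/J is a standard graded K-algebra: J is a proper homogeneous
   ideal (so that A_0 = K). *)
Definition std_graded (J : P -> Prop) : Prop :=
  [/\ is_ideal J, homogeneous_ideal J & ~ J 1].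

(* A = K[x]/J is Koszul: K = A/A_+ has a linear graded free resolution
     ... -> F_3 -> F_2 -> F_1 -> F_0 = A -> K -> 0,
   F_{i+1} = A(-i-1)^(r i), with all differentials given by matrices of
   linear forms (row-vector convention: v |-> v *m M).
   d0 : F_1 -> F_0 and dn i : F_{i+2} -> F_{i+1}. Exactness is modulo J. *)
Definition koszul (J : P -> Prop) : Prop :=
  exists (r : nat -> nat) (d0 : 'M[P]_(r 0, 1))
         (dn : forall i : nat, 'M[P]_(r i.+1, r i)),
      (forall a b, d0 a b \is 1.-homog) /\
      (forall i a b, dn i a b \is 1.-homog) /\
      (forall a b, J ((dn 0 *m d0) a b)) /\
      (forall i a b, J ((dn i.+1 *m dn i) a b)) /\
      (forall p : P, mcoeff 0%MM p = 0 ->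
         exists v : 'rV[P]_(r 0), J (p - (v *m d0) 0 0)) /\
      (forall v : 'rV[P]_(r 0), J ((v *m d0) 0 0) ->
         exists w : 'rV[P]_(r 1), forall j, J ((v - w *m dn 0) 0 j)) /\
      (forall i (v : 'rV[P]_(r i.+1)), (forall j, J ((v *m dn i) 0 j)) ->
         exists w : 'rV[P]_(r i.+2), forall j, J ((v - w *m dn i.+1) 0 j)).

(* p lies in J + (g i : i in S), i.e. the class of p in A = K[x]/J lies in
   the ideal of A generated by the classes of the g i with S i. *)
Definition in_ideal_mod (J : P -> Prop) (I : finType) (S : pred I)
  (g : I -> P) (p : P) : Prop :=
  exists coef : I -> P, J (p - \sum_(i | S i) coef i * g i).

Definition regular_seq (J : P -> Prop) (k : nat) (f : 'I_k -> P) : Prop :=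
  (forall (i : 'I_k) (h : P),
     in_ideal_mod J (fun j : 'I_k => (j < i)%N) f (f i * h) ->
     in_ideal_mod J (fun j : 'I_k => (j < i)%N) f h) /\
  ~ in_ideal_mod J predT f 1.

Definition pow_gens (k : nat) (f : 'I_k -> P) (e : nat)
  (s : {ffun 'I_e -> 'I_k}) : P := \prod_(j < e) f (s j).

Definition in_Ie_t (J : P -> Prop) (k : nat) (f : 'I_k -> P) (e t : nat)
  (p : P) : Prop :=
  p \is t.-homog /\ in_ideal_mod J predT (@pow_gens k f e) p.

Definition is_basis_Iet (J : P -> Prop) (k : nat) (f : 'I_k -> P) (e t : nat)
  (N : nat) (g : N.-tuple P) : Prop :=
  [/\ (forall i, in_Ie_t J f e t (tnth g i)),
      (forall a : 'I_N -> K, J (\sum_i a i *: tnth g i) -> forall i, a i = 0) &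
      (forall p, in_Ie_t J f e t p ->
         exists a : 'I_N -> K, J (p - \sum_i a i *: tnth g i))].

(* Presentation ideal of K[g_1..g_N] ⊆ A: kernel of
   K[y_1..y_N] -> A, y_i |-> class of g_i.  With generators in degree 1,
   K[(I^e)_t] = K[y_1..y_N]/ker_pres J g as a standard graded algebra. *)
Definition ker_pres (J : P -> Prop) (N : nat) (g : N.-tuple P)
  : {mpoly K[N]} -> Prop :=
  fun q => J (q \mPo g).

End Defs.

(* Main.v *)
Require Import Defs.
From Stdlib Require Import Classical ClassicalEpsilon.
From mathcomp Require Import all_boot all_algebra.
From mathcomp Require Import mpoly.
From mathcomp Require Import zify ring.

(* Write A = K[x]/J, S = A[y_1, ..., y_k], T for the diagonal subalgebra of S with
   components S_(cs, es), and R for the algebra K[(I^e)_(ed+c)], a quotient of T by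
   y_i |-> f_i.  All comparisons of resolutions rest on one inductive notion: a
   graded module is i-linear if it is generated in degree 0 and its first syzygy
   module, truncated to degrees >= 1 and shifted, is (i-1)-linear.  If M is i-linear,
   M -> M'' is onto and the truncated, shifted kernel is (i-1)-linear, then M'' is
   i-linear.

   Applied to the linear resolution of K over A and to the Koszul complex of the y_i,
   this makes all diagonals of shifts of S linear over T, as well as those of the
   Koszul cycles of the y_i.  The kernel of S -> A[f_1 t, ..., f_k t] is resolved by
   those cycles, with the Koszul differential of the f_i as boundary; the inequality
   c >= d(k-1)/k says exactly that the diagonals of this resolution start early
   enough for the kernel of T -> R to be linear from degree 2 on.  Hence linearity
   passes from T to R, and the maximal ideal of R is linear over R. *)

Set Implicit Arguments.
Unset Strict Implicit.
Unset Printing Implicit Defensive.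

Import GRing.Theory.
Local Open Scope ring_scope.

(** Shifts of S restrict to diagonals that are not free over T, so the natural exact sequences are
    not free resolutions and cannot be spliced directly. A notion nested over generators and
    truncated syzygies lets each such sequence be consumed one map at a time, the kernel being
    needed to one order less. Minimality is postponed: it is restored only when an actual resolution
    is built, over the residue field in degree 0.

    The kernel of T -> R matters from degree 2 on, because the entries of a relevant syzygy already
    have degree 1 and truncating a kernel adds one more. In its resolution by Koszul cycles, each
    step costs [d] in the degree of A while each truncation gains [c]. Starting from degree 2 of the
    diagonal, where this degree is [2c], the requirement is [(p + 1) d <= (p + 2) c] for
    [p <= k - 2]; the last of these is the hypothesis on [c], and it implies the others. *)

Section LinearMaps.
Variables (S : pzRingType) (V W : lmodType S) (f : V -> W).
Hypothesis fL : linear f.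

Lemma linD x y : f (x + y) = f x + f y.
Proof. by rewrite -[x]scale1r fL !scale1r. Qed.

Lemma lin0 : f 0 = 0.
Proof. by apply: (addrI (f 0)); rewrite -linD !addr0. Qed.

Lemma linZ p x : f (p *: x) = p *: f x.
Proof. by rewrite -[p *: x]addr0 fL lin0 addr0. Qed.

Lemma linN x : f (- x) = - f x.
Proof. by rewrite -scaleN1r linZ scaleN1r. Qed.

Lemma linB x y : f (x - y) = f x - f y.
Proof. by rewrite linD linN. Qed.

End LinearMaps.

Section Combinations.
Variables (S : pzRingType).

Definition lincomb (V : lmodType S) r (m : 'I_r -> V) (v : 'rV[S]_r) : V :=
  \sum_j v 0 j *: m j.

Lemma lincomb_linear (V : lmodType S) r (m : 'I_r -> V) : linear (lincomb m).
Proof.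
move=> p x y; rewrite /lincomb scaler_sumr -big_split /=.
by apply: eq_bigr => j _; rewrite !mxE scalerDl scalerA.
Qed.

Lemma lin_lincomb (V W : lmodType S) (f : V -> W) (fL : linear f) r
    (m : 'I_r -> V) v : f (lincomb m v) = lincomb (f \o m) v.
Proof.
rewrite /lincomb; elim/big_rec2: _ => [|j x y _ <-]; first exact: lin0.
by rewrite linD // linZ.
Qed.

Definition catf (V : Type) r1 r2 (m1 : 'I_r1 -> V) (m2 : 'I_r2 -> V)
  (j : 'I_(r1 + r2)) := match split j with inl j1 => m1 j1 | inr j2 => m2 j2 end.

Lemma catfl (V : Type) r1 r2 (m1 : 'I_r1 -> V) (m2 : 'I_r2 -> V) j :
  catf m1 m2 (lshift r2 j) = m1 j.
Proof. by rewrite /catf (unsplitK (inl _ j)). Qed.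

Lemma catfr (V : Type) r1 r2 (m1 : 'I_r1 -> V) (m2 : 'I_r2 -> V) j :
  catf m1 m2 (rshift r1 j) = m2 j.
Proof. by rewrite /catf (unsplitK (inr _ j)). Qed.

Lemma catfP (V : Type) (Q : V -> Prop) r1 r2 (m1 : 'I_r1 -> V)
    (m2 : 'I_r2 -> V) :
  (forall j, Q (m1 j)) -> (forall j, Q (m2 j)) -> forall j, Q (catf m1 m2 j).
Proof. by move=> h1 h2 j; rewrite /catf; case: split. Qed.

Lemma lincomb_cat (V : lmodType S) r1 r2 (m1 : 'I_r1 -> V) (m2 : 'I_r2 -> V) v :
  lincomb (catf m1 m2) v = lincomb m1 (lsubmx v) + lincomb m2 (rsubmx v).
Proof.
rewrite /lincomb big_split_ord /=; congr (_ + _);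
  by apply: eq_bigr => j _; rewrite ?catfl ?catfr mxE.
Qed.

Lemma row_mxP (Q : S -> Prop) r1 r2 (v1 : 'rV[S]_r1) (v2 : 'rV[S]_r2) :
  (forall j, Q (v1 0 j)) -> (forall j, Q (v2 0 j)) ->
  forall j, Q (row_mx v1 v2 0 j).
Proof.
by move=> h1 h2 j; rewrite mxE; case: split.
Qed.

End Combinations.

(** * Linear graded modules *)

Section Linearity.
Variables (S : comNzRingType) (G : nat -> S -> Prop).

(** The [G s] need not span [S]: for the diagonal they span only a subring. Together with [grM],
    [grN1] makes every [G s] closed under opposites. *)
Record grading : Prop := Grading {
  gr0 : forall s, G s 0;
  grD : forall s p q, G s p -> G s q -> G s (p + q);
  grM : forall t s p q, G t p -> G s q -> G (t + s)%N (p * q);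
  gr1 : G 0%N 1;
  grN1 : G 0%N (-1) }.

Record idealp (J : S -> Prop) : Prop := Idealp {
  id0 : J 0;
  idD : forall p q, J p -> J q -> J (p + q);
  idM : forall r p, J p -> J (r * p) }.

(* The triple (V, Z, B) stands for the graded module whose component of
   degree s is the subquotient Z s / B s of V; it is annihilated by J. *)
Record gmod (J : S -> Prop) (V : lmodType S) (Z B : nat -> V -> Prop) : Prop :=
  Gmod {
  gZ0 : forall s, Z s 0;
  gZD : forall s x y, Z s x -> Z s y -> Z s (x + y);
  gZM : forall t s p x, G t p -> Z s x -> Z (t + s)%N (p *: x);
  gB0 : forall s, B s 0;
  gBD : forall s x y, B s x -> B s y -> B s (x + y);
  gBM : forall t s p x, G t p -> B s x -> B (t + s)%N (p *: x);
  gJ : forall t s p x, J p -> G t p -> Z s x -> B (t + s)%N (p *: x) }.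

Definition gens (V : lmodType S) (Z B : nat -> V -> Prop) r (m : 'I_r -> V) :=
  (forall j, Z 0%N (m j)) /\
  (forall s z, Z s z -> exists v : 'rV[S]_r,
     (forall j, G s (v 0 j)) /\ B s (z - lincomb m v)).

(** Index [s] stands for coefficients of degree [s + 1], so that linear syzygies sit in degree 0,
    where [Lin] expects generators. *)
Definition syz (V : lmodType S) (B : nat -> V -> Prop) r (m : 'I_r -> V) s
  (v : 'rV[S]_r) := (forall j, G s.+1 (v 0 j)) /\ B s.+1 (lincomb m v).

Definition entries (J : S -> Prop) r (v : 'rV[S]_r) := forall j, J (v 0 j).

(* A module generated in degree 0 whose first i syzygy modules are generated in
   the expected degree.  The generators need not be independent over G 0: only
   the syzygies of positive degree matter. *)
Fixpoint Lin (J : S -> Prop) (i : nat) (V : lmodType S)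
    (Z B : nat -> V -> Prop) {struct i} : Prop :=
  exists r (m : 'I_r -> V), gens Z B m /\
    (if i is i'.+1
     then Lin J i' (syz B m) (fun _ : nat => @entries J r) else True).

Variables (J : S -> Prop).
Hypotheses (Ggr : grading) (Jid : idealp J).

Lemma idN p : J p -> J (- p).
Proof. by move=> /(idM Jid (-1)); rewrite mulN1r. Qed.

Lemma idB p q : J p -> J q -> J (p - q).
Proof. by move=> hp hq; apply: idD => //; apply: idN. Qed.

Lemma grN s p : G s p -> G s (- p).
Proof. by move=> h; rewrite -mulN1r; have := grM Ggr (grN1 Ggr) h. Qed.

Section Module.
Variables (V : lmodType S) (Z B : nat -> V -> Prop).
Hypothesis M : gmod J Z B.

Lemma gZN s x : Z s x -> Z s (- x).
Proof. by move=> h; rewrite -scaleN1r; have := gZM M (grN1 Ggr) h. Qed.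

Lemma gBN s x : B s x -> B s (- x).
Proof. by move=> h; rewrite -scaleN1r; have := gBM M (grN1 Ggr) h. Qed.

Lemma gZB s x y : Z s x -> Z s y -> Z s (x - y).
Proof. by move=> hx hy; apply: (gZD M) => //; apply: gZN. Qed.

Lemma gBB s x y : B s x -> B s y -> B s (x - y).
Proof. by move=> hx hy; apply: (gBD M) => //; apply: gBN. Qed.

Lemma gB_sub s x y : B s (x - y) -> B s y -> B s x.
Proof. by move=> h1 h2; rewrite -(subrK y x); apply: (gBD M). Qed.

Lemma gB_sub' s x y : B s (x - y) -> B s x -> B s y.
Proof. by move=> h1 h2; rewrite -(subKr x y); apply: gBB. Qed.

Lemma gZ_lincomb s t r (m : 'I_r -> V) (v : 'rV[S]_r) :
  (forall j, Z t (m j)) -> (forall j, G s (v 0 j)) -> Z (s + t)%N (lincomb m v).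
Proof.
move=> hm hv; rewrite /lincomb.
by elim/big_ind: _ => [|x y|j _]; [exact: (gZ0 M)|exact: (gZD M)|exact: (gZM M)].
Qed.

Lemma gB_lincomb s t r (m : 'I_r -> V) (v : 'rV[S]_r) :
  (forall j, B t (m j)) -> (forall j, G s (v 0 j)) -> B (s + t)%N (lincomb m v).
Proof.
move=> hm hv; rewrite /lincomb.
by elim/big_ind: _ => [|x y|j _]; [exact: (gB0 M)|exact: (gBD M)|exact: (gBM M)].
Qed.

Lemma gJ_lincomb s t r (m : 'I_r -> V) (v : 'rV[S]_r) :
  (forall j, Z t (m j)) -> (forall j, G s (v 0 j)) -> (forall j, J (v 0 j)) ->
  B (s + t)%N (lincomb m v).
Proof.
move=> hm hv hj; rewrite /lincomb.
by elim/big_ind: _ => [|x y|j _]; [exact: (gB0 M)|exact: (gBD M)|exact: (gJ M)].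
Qed.

Lemma gmod_shift : gmod J (fun s => Z s.+1) (fun s => B s.+1).
Proof.
split=> [s|s x y|t s p x|s|s x y|t s p x|t s p x]; rewrite -?addnS.
- exact: (gZ0 M).
- exact: (gZD M).
- exact: (gZM M).
- exact: (gB0 M).
- exact: (gBD M).
- exact: (gBM M).
- exact: (gJ M).
Qed.

End Module.

Lemma gmod_row (Z B : nat -> S^o -> Prop) r :
  gmod J Z B ->
  gmod J (fun s (v : 'rV[S]_r) => forall j, Z s (v 0 j))
         (fun s v => forall j, B s (v 0 j)).
Proof.
move=> M; split=> [s j|s x y hx hy j|t s p x hp hx j|s j|s x y hx hy j
    |t s p x hp hx j|t s p x hp hG hx j]; rewrite !mxE.
- exact: (gZ0 M).
- exact: (gZD M).
- exact: (gZM M).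
- exact: (gB0 M).
- exact: (gBD M).
- exact: (gBM M).
- exact: (gJ M).
Qed.

Lemma gmod_ring : gmod J (G : nat -> S^o -> Prop) (fun _ => J).
Proof.
split=> [s|s x y|t s p x|s|s x y|t s p x|t s p x].
- exact: gr0.
- exact: grD.
- exact: grM.
- exact: id0.
- exact: idD.
- by move=> _; apply: idM.
- by move=> hp _ _; rewrite /GRing.scale /= mulrC; apply: idM.
Qed.

Lemma gmod_restrict (V : lmodType S) (Z B K : nat -> V -> Prop) :
  gmod J Z B -> (forall s, K s 0) ->
  (forall s x y, Z s x -> Z s y -> K s x -> K s y -> K s (x + y)) ->
  (forall t s p x, G t p -> Z s x -> K s x -> K (t + s)%N (p *: x)) ->
  gmod J (fun s x => Z s x /\ K s x) B.
Proof.
move=> M K0 KD KM.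
split=> [s|s x y [zx kx] [zy ky]|t s p x hp [zx kx]|s|s x y|t s p x
  |t s p x hp hG [zx _]].
- by split=> //; exact: (gZ0 M).
- by split; [exact: (gZD M) | exact: KD].
- by split; [exact: (gZM M) | exact: KM].
- exact: (gB0 M).
- exact: (gBD M).
- exact: (gBM M).
- exact: (gJ M).
Qed.

Lemma gmod_syz (V : lmodType S) (Z B : nat -> V -> Prop) r (m : 'I_r -> V) :
  gmod J Z B -> gmod J (syz B m) (fun _ : nat => @entries J r).
Proof.
move=> M; apply: gmod_restrict.
- exact: (gmod_row r (gmod_shift gmod_ring)).
- by move=> s; rewrite lin0; [exact: (gB0 M) | exact: lincomb_linear].
- by move=> s x y _ _ hx hy; rewrite linD; [exact: (gBD M) | exact: lincomb_linear].
- move=> t s p x hp _ hx; rewrite linZ; last exact: lincomb_linear.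
  by rewrite -addnS; apply: (gBM M).
Qed.

Lemma gmod_kernel (V V'' : lmodType S) (Z B : nat -> V -> Prop)
    (Z'' B'' : nat -> V'' -> Prop) (f : V -> V'') :
  linear f -> gmod J Z B -> gmod J Z'' B'' ->
  gmod J (fun s z => Z s.+1 z /\ B'' s.+1 (f z)) (fun s => B s.+1).
Proof.
move=> fL M M''; apply: gmod_restrict.
- exact: gmod_shift.
- by move=> s; rewrite lin0 //; exact: (gB0 M'').
- by move=> s x y _ _ hx hy; rewrite linD //; exact: (gBD M'').
- by move=> t s p x hp _ hx; rewrite linZ // -addnS; apply: (gBM M'').
Qed.

(** * Short exact sequences, extensions and quotients *)

Section ShortExact.
Variables (V' V V'' : lmodType S).
Variables (Z' B' : nat -> V' -> Prop) (Z B : nat -> V -> Prop).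
Variables (Z'' B'' : nat -> V'' -> Prop) (f' : V' -> V) (f : V -> V'').

Record short_exact : Prop := ShortExact {
  seM' : gmod J Z' B';
  seM : gmod J Z B;
  seM'' : gmod J Z'' B'';
  se_lin' : linear f';
  se_lin : linear f;
  se_Z' : forall s z, Z' s z -> Z s (f' z);
  se_B' : forall s z, Z' s z -> (B s (f' z) <-> B' s z);
  se_Z : forall s z, Z s z -> Z'' s (f z);
  se_B : forall s z, Z s z -> B s z -> B'' s (f z);
  se_surj : forall s z, Z'' s z -> exists2 y, Z s y & B'' s (z - f y);
  se_comp : forall s z, Z' s z -> B'' s (f (f' z));
  se_ex : forall s z, Z s z -> B'' s (f z) -> exists2 y, Z' s y & B s (z - f' y) }.

Hypothesis E : short_exact.
Let M' := seM' E.
Let M := seM E.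
Let M'' := seM'' E.
Let fL' := se_lin' E.
Let fL := se_lin E.

Variables (r' r'' : nat) (m' : 'I_r' -> V') (m'' : 'I_r'' -> V'').
Hypotheses (m'g : gens Z' B' m') (m''g : gens Z'' B'' m'').

Lemma lift_gens : exists l : 'I_r'' -> V,
  forall j, Z 0%N (l j) /\ B'' 0%N (m'' j - f (l j)).
Proof.
apply: (@fin_all_exists _ (fun=> V)
  (fun j y => Z 0%N y /\ B'' 0%N (m'' j - f y))) => j.
by have [y] := se_surj E (m''g.1 j); exists y.
Qed.

Variable l : 'I_r'' -> V.
Hypothesis hl : forall j, Z 0%N (l j) /\ B'' 0%N (m'' j - f (l j)).

Lemma lift_Z s (v : 'rV[S]_r'') : (forall j, G s (v 0 j)) -> Z s (lincomb l v).
Proof.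
by move=> hv; rewrite -[s]addn0; apply: (gZ_lincomb M) => // j; case: (hl j).
Qed.

Lemma sub_Z s (v : 'rV[S]_r') : (forall j, G s (v 0 j)) -> Z' s (lincomb m' v).
Proof.
by move=> hv; rewrite -[s]addn0; apply: (gZ_lincomb M') => // j; apply: m'g.1.
Qed.

Lemma lift_B s (v : 'rV[S]_r'') : (forall j, G s (v 0 j)) ->
  B'' s (lincomb m'' v - f (lincomb l v)).
Proof.
move=> hv; rewrite lin_lincomb // /lincomb -sumrB.
under eq_bigr do rewrite /= -scalerBr.
rewrite -[s]addn0; apply: (gB_lincomb M'' (m := fun j => m'' j - f (l j))) => //.
by move=> j; case: (hl j).
Qed.

Lemma cat_gens : gens Z B (catf (f' \o m') l).
Proof.
split.
  by apply: catfP => j /=; [apply: se_Z' E _ _ (m'g.1 j) | case: (hl j)].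
move=> s z hz; have [v'' [gv'' bv'']] := m''g.2 _ _ (se_Z E hz).
have hz1 : Z s (z - lincomb l v'') by apply: (gZB M) => //; apply: lift_Z.
have [|y hy hyB] := se_ex E hz1.
  rewrite linB // -(subrK (lincomb m'' v'') (f z)) -addrA.
  by apply: (gBD M'') => //; exact: lift_B.
have [v' [gv' bv']] := m'g.2 _ _ hy.
exists (row_mx v' v''); split; first exact: row_mxP.
rewrite lincomb_cat row_mxKl row_mxKr -lin_lincomb //.
have -> : z - (f' (lincomb m' v') + lincomb l v'') =
   (z - lincomb l v'' - f' y) + f' (y - lincomb m' v').
  by rewrite linB // addrA subrK opprD [- f' _ - _]addrC addrA.
apply: (gBD M) => //; apply/(se_B' E) => //.
by apply: (gZB M') => //; exact: sub_Z.
Qed.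

End ShortExact.

(** Horseshoe lemma: with images of generators from the left and lifts of generators from the right,
    syzygies form a short exact sequence again. A relation on the right lifts to an element coming
    from the left term, and is corrected by the generators of that term. *)
Lemma syz_exact (V' V V'' : lmodType S)
    (Z' B' : nat -> V' -> Prop) (Z B : nat -> V -> Prop)
    (Z'' B'' : nat -> V'' -> Prop) (f' : V' -> V) (f : V -> V'')
    r' r'' (m' : 'I_r' -> V') (m'' : 'I_r'' -> V'') (l : 'I_r'' -> V) :
  short_exact Z' B' Z B Z'' B'' f' f -> gens Z' B' m' -> 
  (forall j, Z 0%N (l j) /\ B'' 0%N (m'' j - f (l j))) ->
  short_exact (syz B' m') (fun=> @entries J r') (syz B (catf (f' \o m') l))
    (fun=> @entries J (r' + r'')) (syz B'' m'') (fun=> @entries J r'')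
    (fun v' => row_mx v' 0) (fun v => rsubmx v).
Proof.
move=> E m'g hl.
have [M' M M'' fL' fL fZ' fB' fZ fB fsurj ff' fex] := E.
have gl s (v : 'rV[S]_(r' + r'')) : (forall j, G s (v 0 j)) ->
  forall j, G s (lsubmx v 0 j) by move=> hv j; rewrite mxE.
have gr s (v : 'rV[S]_(r' + r'')) : (forall j, G s (v 0 j)) ->
  forall j, G s (rsubmx v 0 j) by move=> hv j; rewrite mxE.
split; [exact: gmod_syz M' | exact: gmod_syz M | exact: gmod_syz M'' | ..].
- by move=> p x y; rewrite scale_row_mx scaler0 add_row_mx addr0.
- by move=> p x y; apply/matrixP => a b; rewrite !mxE.
- move=> s v' [gv' bv']; split.
    by apply: row_mxP => // j; rewrite mxE; exact: gr0.
  rewrite lincomb_cat row_mxKl row_mxKr (lin0 (lincomb_linear _)) addr0.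
  by rewrite -lin_lincomb //; apply/fB' => //; exact: (sub_Z E).
- move=> s v' _; split=> [h j|h].
    by have := h (lshift r'' j); rewrite row_mxEl.
  by apply: row_mxP => // j; rewrite mxE; apply: id0.
- move=> s v [gv bv]; split; first exact: gr.
  move: bv; rewrite lincomb_cat -lin_lincomb // => bv.
  apply: (gB_sub M'') (lift_B E hl (gr _ _ gv)) _.
  have := fB _ _ _ bv; rewrite linD // => h.
  rewrite -(addKr (f (f' (lincomb m' (lsubmx v)))) (f _)) addrC.
  apply: (gBB M''); last by apply: ff'; apply: (sub_Z E) => //; exact: gl.
  apply: h; apply: (gZD M); last by apply: (lift_Z E hl); exact: gr.
  by apply: fZ'; apply: (sub_Z E) => //; exact: gl.
- by move=> s v _ h j; rewrite mxE; apply: h.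
- move=> s v'' [gv'' bv''].
  have [|y hy hyB] := fex _ _ (lift_Z E hl gv'').
    exact: (gB_sub' M'') (lift_B E hl gv'') bv''.
  have [v' [gv' bv']] := m'g.2 _ _ hy.
  exists (row_mx (- v') v''); last first.
    by rewrite row_mxKr subrr => j; rewrite mxE; apply: id0.
  split; first by apply: row_mxP => // j; rewrite mxE; apply: grN.
  rewrite lincomb_cat row_mxKl row_mxKr -lin_lincomb // (linN (lincomb_linear _)).
  have -> : f' (- lincomb m' v') + lincomb l v'' =
     (lincomb l v'' - f' y) + f' (y - lincomb m' v').
    by rewrite linN // linB // addrA subrK addrC.
  by apply: (gBD M) => //; apply/fB' => //; apply: (gZB M') => //; exact: (sub_Z E).
- by move=> s v' _ j; rewrite row_mxKr mxE; apply: id0.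
- move=> s v [gv bv] hJ; exists (lsubmx v).
    split; first exact: gl.
    apply/fB'; first by apply: (sub_Z E) => //; exact: gl.
    move: bv; rewrite lincomb_cat -lin_lincomb // => bv.
    rewrite -[f' _](addrK (lincomb l (rsubmx v))).
    apply: (gBB M) => //; rewrite -[s.+1]addn0; apply: (gJ_lincomb M) => //.
      by move=> j; case: (hl j).
    exact: gr.
  move=> j; rewrite -{1}(hsubmxK v) opp_row_mx add_row_mx subrr oppr0 addr0.
  by apply: row_mxP j => // j; rewrite mxE; apply: id0.
Qed.

Lemma Lin_extension i : forall (V' V V'' : lmodType S)
    (Z' B' : nat -> V' -> Prop) (Z B : nat -> V -> Prop)
    (Z'' B'' : nat -> V'' -> Prop) (f' : V' -> V) (f : V -> V''),
  short_exact Z' B' Z B Z'' B'' f' f ->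
  Lin J i Z' B' -> Lin J i Z'' B'' -> Lin J i Z B.
Proof.
elim: i => [|i IH] V' V V'' Z' B' Z B Z'' B'' f' f E
  [r' [m' [m'g L']]] [r'' [m'' [m''g L'']]];
  have [l hl] := lift_gens E m''g;
  exists (r' + r'')%N, (catf (f' \o m') l); split=> //.
- exact: (cat_gens E m'g m''g hl).
- exact: (cat_gens E m'g m''g hl).
exact: IH (syz_exact E m'g hl) L' L''.
Qed.

(** The images of generators of the source M generate the target M''. For this choice, evaluating a
    syzygy of M'' at the generators of M lands in the truncated kernel, which gives
    [0 -> syz M -> syz M'' -> ker -> 0], and [Lin_extension] applies. *)
Lemma Lin_quotient i (V V'' : lmodType S)
    (Z B : nat -> V -> Prop) (Z'' B'' : nat -> V'' -> Prop) (f : V -> V'') :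
  gmod J Z B -> gmod J Z'' B'' -> linear f ->
  (forall s z, Z s z -> Z'' s (f z)) ->
  (forall s z, Z s z -> B s z -> B'' s (f z)) ->
  (forall s z, Z'' s z -> exists2 y, Z s y & B'' s (z - f y)) ->
  Lin J i Z B ->
  (forall i', i = i'.+1 ->
     Lin J i' (fun s z => Z s.+1 z /\ B'' s.+1 (f z)) (fun s => B s.+1)) ->
  Lin J i Z'' B''.
Proof.
move=> M M'' fL fZ fB fsurj.
have step r (m : 'I_r -> V) : gens Z B m -> gens Z'' B'' (f \o m).
  move=> [m0 mg]; split=> [j|s z hz]; first by apply: fZ; apply: m0.
  have [y hy hyB] := fsurj _ _ hz; have [v [gv bv]] := mg _ _ hy.
  exists v; split=> //; rewrite -lin_lincomb //.
  rewrite -(subrK (f y) z) -addrA -linB //; apply: (gBD M'') => //.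
  apply: fB => //; apply: (gZB M) => //.
  by rewrite -[s]addn0; apply: (gZ_lincomb M).
case: i => [|i] [r [m [mg L]]] LK; exists r, (f \o m); split=> //; try exact: step.
have hmZ s (v : 'rV[S]_r) : (forall j, G s (v 0 j)) -> Z s (lincomb m v).
  by move=> hv; rewrite -[s]addn0; apply: (gZ_lincomb M) => // j; apply: mg.1.
apply: (@Lin_extension i _ _ _ _ _ _ _ _ _ id (lincomb m) _ L (LK i erefl)).
split=> //; try exact: lincomb_linear.
- exact: gmod_syz M.
- exact: gmod_syz M''.
- exact: (gmod_kernel fL M M'').
- move=> s v [gv bv]; split=> //; rewrite -lin_lincomb //.
  by apply: fB => //; exact: hmZ.
- by move=> s v [gv bv]; split; [exact: hmZ | rewrite lin_lincomb].
- by move=> s v [gv _] hv; rewrite -[s.+1]addn0; apply: (gJ_lincomb M) => // j; apply: mg.1.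
- move=> s z [hz hzB]; have [v [gv bv]] := mg.2 _ _ hz.
  exists v => //; split=> //; rewrite -lin_lincomb //.
  apply: (gB_sub' M'') hzB; rewrite -linB //.
  by apply: fB => //; apply: (gZB M) => //; apply: hmZ.
- by move=> s v [].
- move=> s v [gv bv] hv; exists v => //; rewrite subrr => j; rewrite mxE; exact: id0.
Qed.

Lemma Lin_zero i : forall (V : lmodType S) (Z B : nat -> V -> Prop),
  (forall s z, Z s z -> B s z) -> Lin J i Z B.
Proof.
elim: i => [|i IH] V Z B h; exists 0%N, (fun=> 0); split=> //.
3: by apply: IH => s v _ [].
all: split=> [[]//|s z hz]; exists 0; split=> [[]//|].
all: by rewrite (lin0 (lincomb_linear _)) subr0; apply: h.
Qed.

Lemma Lin_iso i (V V'' : lmodType S)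
    (Z B : nat -> V -> Prop) (Z'' B'' : nat -> V'' -> Prop) (f : V -> V'') :
  gmod J Z B -> gmod J Z'' B'' -> linear f ->
  (forall s z, Z s z -> Z'' s (f z)) ->
  (forall s z, Z s z -> (B'' s (f z) <-> B s z)) ->
  (forall s z, Z'' s z -> exists2 y, Z s y & B'' s (z - f y)) ->
  Lin J i Z B -> Lin J i Z'' B''.
Proof.
move=> M M'' fL fZ fB fsurj L; apply: (Lin_quotient M M'' fL) => //.
  by move=> s z hz /(fB _ _ hz).
by move=> i' _; apply: Lin_zero => s z [hz /(fB _ _ hz)].
Qed.

Lemma Lin_ext i (V : lmodType S) (Z B Z2 B2 : nat -> V -> Prop) :
  gmod J Z B ->
  (forall s z, Z s z <-> Z2 s z) -> (forall s z, B s z <-> B2 s z) ->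
  Lin J i Z B -> Lin J i Z2 B2.
Proof.
move=> M hZ hB; have M2 : gmod J Z2 B2.
  split=> [s|s x y|t s p x hp|s|s x y|t s p x hp|t s p x hJ hp];
    rewrite -?hZ -?hB; by case: M => *; eauto.
apply: (Lin_iso (f := id) M M2) => //.
- by move=> s z /hZ.
- by move=> s z _; rewrite hB.
- by move=> s z /hZ hz; exists z => //; rewrite subrr; exact: gB0 M2 _.
Qed.

Lemma Lin_row i (Z B : nat -> S^o -> Prop) r :
  gmod J Z B -> Lin J i Z B ->
  Lin J i (fun s (v : 'rV[S]_r) => forall j, Z s (v 0 j))
          (fun s v => forall j, B s (v 0 j)).
Proof.
move=> M L; elim: r => [|r IH]; first by apply: Lin_zero => s z _ [].
rewrite -[r.+1]/(1 + r)%N; apply: (@Lin_extension i _ _ _ _ _ _ _ _ _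
   (fun v : 'rV[S]_r => row_mx (0 : 'rV_1) v)
   (fun v : 'rV[S]_(1 + r) => v 0 (lshift r 0) : S^o) _ IH L).
split=> //; try exact: gmod_row.
- by move=> p x y; rewrite scale_row_mx scaler0 add_row_mx addr0.
- by move=> p x y; rewrite !mxE.
- by move=> s v h; apply: (@row_mxP _ (Z s)) => // j; rewrite mxE; exact: (gZ0 M).
- move=> s v _; split=> [h j|h]; first by have := h (rshift 1 j); rewrite row_mxEr.
  by apply: row_mxP => // j; rewrite mxE; exact: (gB0 M).
- move=> s z hz; exists (row_mx (const_mx z) 0); last first.
    by rewrite row_mxEl mxE subrr; exact: (gB0 M).
  by apply: row_mxP => j; rewrite mxE //; exact: (gZ0 M).
- by move=> s z _; rewrite row_mxEl mxE; exact: (gB0 M).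
- move=> s v hv h0; exists (rsubmx v); first by move=> j; rewrite mxE.
  move=> j; rewrite -{1}(hsubmxK v) opp_row_mx add_row_mx subrr subr0.
  apply: row_mxP j => j; rewrite mxE; last exact: (gB0 M).
  by rewrite (ord1 j).
Qed.

Lemma Lin_free i : Lin J i (G : nat -> S^o -> Prop) (fun _ => J).
Proof.
have lc1 (v : 'rV[S]_1) : lincomb (fun=> 1 : S^o) v = v 0 0.
  by rewrite /lincomb big_ord1 /GRing.scale /= mulr1.
case: i => [|i]; exists 1%N, (fun=> 1); split=> //.
3: apply: Lin_zero => s v [_]; rewrite lc1 => h j; by rewrite (ord1 j).
all: split=> [j|s z hz]; first exact: gr1.
all: exists (const_mx z); split=> [j|]; rewrite ?lc1 mxE //.
all: by rewrite subrr; exact: id0.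
Qed.

End Linearity.

(** * Change of rings *)

Section ChangeOfRings.
Variables (S : comNzRingType) (G : nat -> S -> Prop) (J J2 : S -> Prop).
Hypotheses (Ggr : grading G) (Jid : idealp J) (J2id : idealp J2).
Hypothesis JJ2 : forall p, J p -> J2 p.

Lemma gmod_weaken (V : lmodType S) (Z B : nat -> V -> Prop) :
  gmod G J2 Z B -> gmod G J Z B.
Proof. by case=> *; split=> // t s p x /JJ2; auto. Qed.

(* Passing from S/J to S/J2 preserves linearity when J2/J has regularity at
   most 2: the syzygies over S/J2 are those over S/J modulo copies of J2/J. *)
Lemma Lin_change_of_rings i :
  (forall i, Lin G J i (fun s (q : S^o) => G s.+2 q /\ J2 q) (fun _ => J)) ->
  forall (V : lmodType S) (Z B : nat -> V -> Prop),
  gmod G J2 Z B -> Lin G J i Z B -> Lin G J2 i Z B.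
Proof.
move=> L2; elim: i => [|i IH] V Z B M2 [r [m [mg L]]]; exists r, m; split=> //.
have M := gmod_weaken M2.
have MS2 := gmod_syz Ggr J2id m M2.
apply: IH => //; apply: (Lin_quotient (f := id) Ggr Jid _ _ _ _ _ _ L) => //.
- exact: (gmod_syz Ggr Jid m M).
- exact: gmod_weaken MS2.
- by move=> s v _ h j; apply: JJ2.
- by move=> s v hv; exists v => // j; rewrite subrr mxE; exact: id0.
move=> i' _.
have MK : gmod G J (fun s (q : S^o) => G s.+2 q /\ J2 q) (fun _ => J).
  apply: gmod_restrict.
  - exact: (gmod_shift (gmod_shift (gmod_ring Ggr Jid))).
  - by move=> _; exact: (id0 J2id).
  - by move=> s x y _ _; exact: (idD J2id).
  - by move=> t s p x _ _; exact: (idM J2id).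
apply: (Lin_ext Ggr Jid _ _ _ (Lin_row Ggr Jid r MK (L2 i'))) => //.
- exact: (gmod_row r MK).
(* A row with entries in [J2] is a syzygy because [J2] annihilates the module. The index [s.+2] adds
   the shift of [syz] to that of the truncated kernel. *)
- move=> s v; split=> [h|[[gv bv] h] j]; last by split; [exact: gv | exact: h].
  split; last by move=> j; case: (h j).
  split=> [j|]; first by case: (h j).
  rewrite -[s.+2]addn0; apply: (gJ_lincomb M2 (t := 0%N)).
  - exact: mg.1.
  - by move=> j; case: (h j).
  - by move=> j; case: (h j).
Qed.

End ChangeOfRings.

(** * Minimal linear resolutions *)

Section Matrices.
Variables (S : comNzRingType) (G : nat -> S -> Prop) (J : S -> Prop).
Hypotheses (Ggr : grading G) (Jid : idealp J).

Lemma lincomb_mul (V : lmodType S) r1 r2 (m : 'I_r2 -> V) (v : 'rV[S]_r1)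
    (D : 'M[S]_(r1, r2)) :
  lincomb m (v *m D) = lincomb (fun j => lincomb m (row j D)) v.
Proof.
rewrite /lincomb; under [RHS]eq_bigr do rewrite scaler_sumr.
rewrite exchange_big /=; apply: eq_bigr => j _.
rewrite mxE scaler_suml; apply: eq_bigr => i _.
by rewrite mxE scalerA.
Qed.

Lemma mulmx_lincomb r1 r2 (v : 'rV[S]_r1) (D : 'M[S]_(r1, r2)) :
  lincomb (fun j => row j D : 'rV[S]_r2) v = v *m D.
Proof. by rewrite mulmx_sum_row. Qed.

Lemma gr_mulmx s t r1 r2 (v : 'rV[S]_r1) (D : 'M[S]_(r1, r2)) :
  (forall j, G s (v 0 j)) -> (forall a b, G t (D a b)) ->
  forall j, G (s + t)%N ((v *m D) 0 j).
Proof.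
move=> hv hD j; rewrite mxE.
elim/big_ind: _ => [|x y|a _]; [exact: gr0 | exact: grD | exact: grM].
Qed.

Lemma idealp_mulmx r1 r2 (v : 'rV[S]_r1) (D : 'M[S]_(r1, r2)) :
  (forall j, J (v 0 j)) -> forall j, J ((v *m D) 0 j).
Proof.
move=> hv j; rewrite mxE.
elim/big_ind: _ => [|x y|a _]; [exact: id0 | exact: idD | ].
by rewrite mulrC; apply: idM.
Qed.

Hypothesis L1 : forall i, Lin G J i (fun s => G s.+1 : S^o -> Prop) (fun _ => J).
Hypothesis L2 : forall i, Lin G J i (fun s => G s.+2 : S^o -> Prop) (fun _ => J).

Let MR := gmod_ring Ggr Jid.

(** [Lin] yields linear syzygies for some generators [m]; they are transferred to the given [m2]
    through the concatenation. The syzygies of [catf m m2] contain those of [m] with quotient copies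
    of the ring in degrees >= 1 ([L1]), and they project onto those of [m2] with truncated kernel
    copies of the ring in degrees >= 2 ([L2]). *)
Lemma Lin_any_gens (V : lmodType S) (Z B : nat -> V -> Prop) r2 (m2 : 'I_r2 -> V) :
  gmod G J Z B -> (forall i, Lin G J i Z B) -> gens G Z B m2 ->
  forall i, Lin G J i (syz G B m2) (fun _ => @entries S J r2).
Proof.
move=> M LM m2g i; have [r [m [mg L]]] := LM i.+1.
have hmZ s (v : 'rV[S]_r) : (forall j, G s (v 0 j)) -> Z s (lincomb m v).
  by move=> hv; rewrite -[s]addn0; apply: (gZ_lincomb M) => // j; apply: mg.1.
have hmZ2 s (v : 'rV[S]_r2) : (forall j, G s (v 0 j)) -> Z s (lincomb m2 v).
  by move=> hv; rewrite -[s]addn0; apply: (gZ_lincomb M) => // j; apply: m2g.1.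
have LN : Lin G J i (syz G B (catf m m2)) (fun _ => @entries S J (r + r2)).
  apply: (Lin_extension (f' := fun v' : 'rV[S]_r => row_mx v' (0 : 'rV_r2))
    (f := fun v => rsubmx v) Ggr Jid _ L
    (Lin_row Ggr Jid r2 (gmod_shift MR) (L1 i))).
  split.
  - exact: gmod_syz M.
  - exact: gmod_syz M.
  - exact: (gmod_row r2 (gmod_shift MR)).
  - by move=> p x y; rewrite scale_row_mx scaler0 add_row_mx addr0.
  - by move=> p x y; apply/matrixP => a b; rewrite !mxE.
  - move=> s v [gv bv]; split.
      by apply: row_mxP => // j; rewrite mxE; exact: gr0.
    by rewrite lincomb_cat row_mxKl row_mxKr (lin0 (lincomb_linear _)) addr0.
  - move=> s v _; split=> [h j|h].
      by have := h (lshift r2 j); rewrite row_mxEl.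
    by apply: row_mxP => // j; rewrite mxE; exact: id0.
  - by move=> s v [gv _] j; rewrite mxE; exact: gv.
  - by move=> s v _ h j; rewrite mxE; exact: h.
  - move=> s w gw; have [v [gv bv]] := mg.2 _ _ (hmZ2 _ _ gw).
    exists (row_mx (- v) w); last first.
      by move=> j; rewrite row_mxKr subrr mxE; exact: id0.
    split; first by apply: row_mxP => // j; rewrite mxE; exact: grN.
    rewrite lincomb_cat row_mxKl row_mxKr (linN (lincomb_linear _)) addrC.
    exact: bv.
  - by move=> s v _ j; rewrite row_mxKr mxE; exact: id0.
  - move=> s v [gv bv] hJ; exists (lsubmx v).
      split=> [j|]; first by rewrite mxE; exact: gv.
      move: bv; rewrite lincomb_cat => bv.
      rewrite -[lincomb m _](addrK (lincomb m2 (rsubmx v))).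
      apply: (gBB Ggr M) => //; rewrite -[s.+1]addn0; apply: (gJ_lincomb M) => //.
        exact: m2g.1.
      by move=> j; rewrite mxE; exact: gv.
    move=> j; rewrite -{1}(hsubmxK v) opp_row_mx add_row_mx subrr subr0.
    by apply: row_mxP j => // j; rewrite mxE; exact: id0.
have [D hD] : exists D : 'I_r -> 'rV[S]_r2, forall j,
    (forall b, G 0%N (D j 0 b)) /\ B 0%N (m j - lincomb m2 (D j)).
  apply: (@fin_all_exists _ (fun=> 'rV[S]_r2) (fun j (w : 'rV[S]_r2) =>
    (forall b, G 0%N (w 0 b)) /\ B 0%N (m j - lincomb m2 w))) => j.
  by have [w] := m2g.2 _ _ (mg.1 j); exists w.
pose DM : 'M[S]_(r, r2) := \matrix_(a, b) D a 0 b.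
have rDM j : row j DM = D j by apply/rowP => b; rewrite !mxE.
have gDM a b : G 0%N (DM a b) by rewrite mxE; apply: (hD a).1.
have gmulDM s (v : 'rV[S]_r) : (forall j, G s (v 0 j)) ->
    forall j, G s ((v *m DM) 0 j).
  by move=> gv j; rewrite -[s]addn0; apply: gr_mulmx.
have bDM s (v : 'rV[S]_r) : (forall j, G s (v 0 j)) ->
    B s (lincomb m v - lincomb m2 (v *m DM)).
  move=> gv; rewrite lincomb_mul /lincomb -sumrB.
  rewrite (eq_bigr (fun j => v 0 j *: (m j - lincomb m2 (D j)))); last first.
    by move=> j _; rewrite scalerBr rDM.
  rewrite -[s]addn0; apply: (gB_lincomb M (m := fun j => m j - lincomb m2 (D j))) => //.
  by move=> j; apply: (hD j).2.
(* [f] eliminates [m] by substituting its expression [DM] in terms of [m2]. *)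
pose f (v : 'rV[S]_(r + r2)) := rsubmx v + lsubmx v *m DM.
have fL : linear f.
  move=> p x y; rewrite /f.
  have -> : lsubmx (p *: x + y) = p *: lsubmx x + lsubmx y.
    by apply/matrixP => a b; rewrite !mxE.
  have -> : rsubmx (p *: x + y) = p *: rsubmx x + rsubmx y.
    by apply/matrixP => a b; rewrite !mxE.
  by rewrite mulmxDl -scalemxAl scalerDr addrACA.
have Mcat := gmod_syz Ggr Jid (catf m m2) M.
apply: (Lin_quotient (f := f) Ggr Jid Mcat _ _ _ _ _ LN) => //.
- exact: gmod_syz M.
- move=> s v [gv bv]; split.
    move=> j; rewrite mxE; apply: grD => //; first by rewrite mxE; exact: gv.
    by apply: gmulDM => j'; rewrite mxE; exact: gv.
  have gl : forall j, G s.+1 (lsubmx v 0 j) by move=> j; rewrite mxE; exact: gv.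
  have := gBB Ggr M bv (bDM _ _ gl).
  by rewrite /f (linD (lincomb_linear _)) lincomb_cat opprB [_ + (_ - _)]addrC subrKA addrC.
- move=> s v _ h j; rewrite /f mxE; apply: idD => //; first by rewrite mxE; exact: h.
  by apply: idealp_mulmx => // j'; rewrite mxE; exact: h.
- move=> s w [gw bw]; exists (row_mx 0 w).
    split; first by apply: row_mxP => // j; rewrite mxE; exact: gr0.
    by rewrite lincomb_cat row_mxKl row_mxKr (lin0 (lincomb_linear _)) add0r.
  by move=> j; rewrite /f row_mxKl row_mxKr mul0mx addr0 subrr mxE; exact: id0.
move=> i' _.
(* Modulo J, the kernel of [f] is the graph of [w |-> - (w *m DM)]. *)
apply: (Lin_iso (f := fun w : 'rV[S]_r => row_mx w (- (w *m DM))) Ggr Jid _ _ _ _ _ _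
   (Lin_row Ggr Jid r (gmod_shift (gmod_shift MR)) (L2 i'))).
- exact: (gmod_row r (gmod_shift (gmod_shift MR))).
- exact: (gmod_kernel fL Mcat (gmod_syz Ggr Jid m2 M)).
- by move=> p x y; rewrite mulmxDl -scalemxAl opprD -scalerN scale_row_mx add_row_mx.
- move=> s w gw; split.
    split; first by apply: row_mxP => // j; rewrite mxE; apply: grN => //; exact: gmulDM.
    rewrite lincomb_cat row_mxKl row_mxKr (linN (lincomb_linear _)).
    exact: bDM.
  by move=> j; rewrite /f row_mxKl row_mxKr addNr mxE; exact: id0.
- move=> s w gw; split=> [h j|h].
    by have := h (lshift r2 j); rewrite row_mxEl.
  apply: row_mxP => // j; rewrite mxE; apply: idN => //.
  exact: idealp_mulmx.
- move=> s v [[gv bv] hv]; exists (lsubmx v).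
    by move=> j; rewrite mxE; exact: gv.
  move=> j; rewrite -{1}(hsubmxK v) opp_row_mx add_row_mx subrr opprK.
  by apply: row_mxP j => // j; rewrite mxE; exact: id0.
Qed.

Definition indep (V : lmodType S) (B : nat -> V -> Prop) r (m : 'I_r -> V) :=
  forall v : 'rV[S]_r, (forall j, G 0%N (v 0 j)) -> B 0%N (lincomb m v) ->
  forall j, J (v 0 j).

Hypothesis Gfield : forall q, G 0%N q -> J q \/ exists2 q', G 0%N q' & q' * q = 1.

Lemma exists_basis (V : lmodType S) (Z B : nat -> V -> Prop) r (m : 'I_r -> V) :
  gmod G J Z B -> gens G Z B m ->
  exists r' (m' : 'I_r' -> V), gens G Z B m' /\ indep B m'.
Proof.
move=> M; elim: r m => [|r IH] m mg; first by exists 0%N, m; split=> // v _ _ [].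
have [h|h] := classic (indep B m); first by exists r.+1, m.
have {h} [a ha] := not_all_ex_not _ _ h.
have {ha} [ga ha] := imply_to_and _ _ ha.
have {ha} [ba ha] := imply_to_and _ _ ha.
have {ha} [j0 ja] := not_all_ex_not _ _ ha.
have [//|[q gq qa]] := Gfield (ga j0).
apply: (IH (fun j => m (lift j0 j))); split=> [j|s z hz]; first exact: mg.1.
have [v [gv bv]] := mg.2 _ _ hz.
have lift_lc (w : 'rV[S]_r.+1) : lincomb m w =
    w 0 j0 *: m j0 + lincomb (fun j => m (lift j0 j)) (\row_j w 0 (lift j0 j)).
  rewrite /lincomb (bigD1_ord j0) //=; congr (_ + _).
  by apply: eq_bigr => j _; rewrite mxE.
(* Subtracting a multiple of the relation [a], whose entry at [j0] has inverse [q], kills the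
   coefficient of [m j0] and changes the combination only by an element of [B]. *)
pose w := v - (v 0 j0 * q) *: a.
have gw j : G s (w 0 j).
  rewrite !mxE; apply: grD => //; apply: grN => //.
  rewrite -[s]addn0; apply: grM => //; rewrite -[s]addn0; exact: grM.
exists (\row_j w 0 (lift j0 j)); split=> [j|]; first by rewrite mxE.
have -> : lincomb (fun j => m (lift j0 j)) (\row_j w 0 (lift j0 j)) = lincomb m w.
  rewrite lift_lc; have -> : w 0 j0 = 0 by rewrite !mxE -mulrA qa mulr1 subrr.
  by rewrite scale0r add0r.
rewrite (linB (lincomb_linear _)) (linZ (lincomb_linear _)) opprB addrCA.
apply: (gBD M) => //.
by rewrite -[s]addn0; apply: (gBM M) => //; rewrite -[s]addn0; apply: grM.
Qed.

Lemma LinAll_basis (V : lmodType S) (Z B : nat -> V -> Prop) :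
  gmod G J Z B -> (forall i, Lin G J i Z B) ->
  exists r (m : 'I_r -> V), [/\ gens G Z B m, indep B m &
    forall i, Lin G J i (syz G B m) (fun _ => @entries S J r)].
Proof.
move=> M L; have [r0 [m0 [mg0 _]]] := L 0%N.
have [r [m [mg mi]]] := exists_basis M mg0.
by exists r, m; split=> //; exact: (Lin_any_gens M L mg).
Qed.

Definition mxker r' r (D : 'M[S]_(r', r)) s (v : 'rV[S]_r') :=
  (forall j, G s.+1 (v 0 j)) /\ entries J (v *m D).

(** The second clause concerns the degree 0 part of the kernel, which the shifted [mxker] does not
    see. It comes from minimality of the generators and gives exactness in degree 0. *)
Definition good_mx r' r (D : 'M[S]_(r', r)) :=
  [/\ (forall a b, G 1%N (D a b)),
      (forall v : 'rV[S]_r', (forall j, G 0%N (v 0 j)) -> entries J (v *m D) ->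
         entries J v) &
      (forall i, Lin G J i (mxker D) (fun _ => @entries S J r'))].

Definition next_mx r' r (D : 'M[S]_(r', r)) r'' (D' : 'M[S]_(r'', r')) :=
  [/\ good_mx D', (forall a b, J ((D' *m D) a b)) &
      (forall s v, mxker D s v -> exists2 w : 'rV[S]_r'',
         (forall j, G s (w 0 j)) & entries J (v - w *m D'))].

Lemma good_mx_next r' r (D : 'M[S]_(r', r)) :
  good_mx D -> exists r'' (D' : 'M[S]_(r'', r')), next_mx D D'.
Proof.
move=> [gD iD LD].
have MD : gmod G J (mxker D) (fun _ => @entries S J r').
  apply: gmod_restrict.
  - exact: (gmod_row r' (gmod_shift MR)).
  - by move=> s j; rewrite mul0mx mxE; exact: id0.
  - by move=> s x y _ _ hx hy j; rewrite mulmxDl mxE; exact: idD.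
  - by move=> t s p x _ _ hx j; rewrite -scalemxAl mxE; exact: idM.
have [r'' [m [mg mi Lm]]] := LinAll_basis MD LD.
pose D' : 'M[S]_(r'', r') := \matrix_(a, b) m a 0 b.
have rD' a : row a D' = m a by apply/rowP => b; rewrite !mxE.
have lcD' v : lincomb m v = v *m D'.
  by rewrite -mulmx_lincomb; apply: eq_bigr => j _; rewrite rD'.
exists r'', D'; split.
- split.
  + by move=> a b; rewrite mxE; apply: (mg.1 a).1.
  + by move=> v gv; rewrite -lcD'; apply: mi.
  + move=> i; apply: (Lin_ext Ggr Jid _ _ _ (Lm i)) => //; first exact: gmod_syz MD.
    by move=> s v; rewrite /syz /mxker lcD'.
- move=> a b; have := (mg.1 a).2 b.
  by rewrite -rD' -row_mul mxE.
- move=> s v hv; have [w [gw bw]] := mg.2 _ _ hv.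
  by exists w; rewrite -?lcD'.
Qed.

Lemma linear_resolution :
  exists (r : nat -> nat) (d0 : 'M[S]_(r 0, 1))
         (dn : forall i : nat, 'M[S]_(r i.+1, r i)),
  [/\ good_mx d0, 
      (forall s p, G s.+1 p -> exists2 v : 'rV[S]_(r 0),
         (forall j, G s (v 0 j)) & J (p - (v *m d0) 0 0)),
      next_mx d0 (dn 0%N) & forall i, next_mx (dn i) (dn i.+1)].
Proof.
have M1 : gmod G J (fun s => G s.+1 : S^o -> Prop) (fun _ => J) := gmod_shift MR.
have [r0 [m [mg mi Lm]]] := LinAll_basis M1 L1.
pose D0 : 'M[S]_(r0, 1) := \matrix_(a, b) m a.
have lcD0 v : (v *m D0) 0 0 = lincomb m v.
  by rewrite mxE; apply: eq_bigr => j _; rewrite mxE.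
have lcD0J v : entries J (v *m D0) <-> J (lincomb m v).
  by rewrite -lcD0; split=> [h|h j]; [exact: h | rewrite (ord1 j)].
have good0 : good_mx D0.
  split.
  + by move=> a b; rewrite mxE; apply: mg.1.
  + by move=> v gv /lcD0J; apply: mi.
  + move=> i; apply: (Lin_ext Ggr Jid _ _ _ (Lm i)) => //; first exact: gmod_syz M1.
    by move=> s v; split=> [] [gv] /lcD0J.
(* Matrices are packed with their dimensions, the number of rows second, so that the construction of
   the next one can be iterated. *)
pose st := {p : nat * nat & 'M[S]_(p.2, p.1)}.
have nextP (x : st) : exists y : {r'' : nat & 'M[S]_(r'', (projT1 x).2)},
    good_mx (projT2 x) -> next_mx (projT2 x) (projT2 y).
  have [h|h] := classic (good_mx (projT2 x)).
    by have [r'' [D' hD']] := good_mx_next h; exists (existT _ r'' D').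
  (* An empty matrix as default, to make the successor a total function. *)
  by exists (existT (fun r'' => 'M[S]_(r'', (projT1 x).2)) 0%N (const_mx 0)).
pose nx x := proj1_sig (constructive_indefinite_description _ (nextP x)).
have nxP x : good_mx (projT2 x) -> next_mx (projT2 x) (projT2 (nx x)).
  exact: (proj2_sig (constructive_indefinite_description _ (nextP x))).
pose step (x : st) : st :=
  existT (fun p : nat * nat => 'M[S]_(p.2, p.1)) ((projT1 x).2, projT1 (nx x))
    (projT2 (nx x)).
pose x0 : st := existT (fun p : nat * nat => 'M[S]_(p.2, p.1)) (1%N, r0) D0.
pose x := fix x i := if i is i'.+1 then step (x i') else x0.
have xg i : good_mx (projT2 (x i)).
  by elim: i => [|i IH] //=; have [] := nxP _ IH.
exists (fun i => (projT1 (x i)).2), D0, (fun i => projT2 (x i.+1)); split=> //.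
- by move=> s p hp; have [v [gv bv]] := mg.2 _ _ hp; exists v; rewrite ?lcD0.
- exact: (nxP _ (xg 0%N)).
- move=> i; exact: (nxP _ (xg i.+1)).
Qed.

End Matrices.

(** * The Koszul complex *)

Section KoszulComplex.
Variable S : comNzRingType.

(* The exterior algebra on l generators, as iterated pairs:
   Lambda(l+1) = Lambda(l) + Lambda(l) e_l. *)
Fixpoint ext l : lmodType S :=
  if l is l'.+1 then (ext l' * ext l')%type else S^o.

(** The signs are those of [d (e_l v) = g_l v - e_l (d v)], the pair [(u, v)] standing for
    [u + e_l v]. *)
Fixpoint kd (g : nat -> S) l : ext l -> ext l :=
  match l return ext l -> ext l with
  | 0 => fun _ => 0
  | l'.+1 => fun w => (kd g w.1 + g l' *: w.2, - kd g w.2)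
  end.

Fixpoint ext_deg (i : nat) l : ext l -> Prop :=
  match l return ext l -> Prop with
  | 0 => fun w => if i is 0 then True else w = 0
  | l'.+1 => fun w => ext_deg i w.1 /\
      (if i is i'.+1 then ext_deg i' w.2 else w.2 = 0)
  end.

Fixpoint ext_all (Q : S -> Prop) l : ext l -> Prop :=
  match l return ext l -> Prop with
  | 0 => Q
  | l'.+1 => fun w => ext_all Q w.1 /\ ext_all Q w.2
  end.

Fixpoint ext_map (h : S -> S) l : ext l -> ext l :=
  match l return ext l -> ext l with
  | 0 => h
  | l'.+1 => fun w => (ext_map h w.1, ext_map h w.2)
  end.

Fixpoint ext_inj l : S -> ext l :=
  match l return S -> ext l with
  | 0 => id
  | l'.+1 => fun s => (ext_inj l' s, 0)
  end.

Fixpoint ext_pr l : ext l -> S :=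
  match l return ext l -> S with
  | 0 => id
  | l'.+1 => fun w => ext_pr w.1
  end.

Lemma kd_linear g l : linear (@kd g l).
Proof.
elim: l => [|l IH] p; first by move=> x y; rewrite scaler0 addr0.
move=> [x1 x2] [y1 y2]; rewrite -[RHS]/(p *: (kd g x1 + g l *: x2) +
  (kd g y1 + g l *: y2), p *: (- kd g x2) - kd g y2) /=.
congr pair; last by rewrite IH opprD scalerN.
by rewrite IH !scalerDr !scalerA [p * _]mulrC addrACA.
Qed.

Lemma ext_inj_linear l : linear (@ext_inj l : S^o -> ext l).
Proof.
elim: l => [|l IH] p x y //.
rewrite -[RHS]/(p *: ext_inj l x + ext_inj l y, p *: 0 + 0) /= IH.
by rewrite scaler0 addr0.
Qed.

Lemma ext_pr_linear l : linear (@ext_pr l : ext l -> S^o).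
Proof. by elim: l => [|l IH] p x y //=; rewrite IH. Qed.

Lemma ext_injK l : cancel (@ext_inj l) (@ext_pr l).
Proof. by elim: l. Qed.

Lemma ext_deg0_inj l (w : ext l) : ext_deg 0 w -> w = ext_inj l (ext_pr w).
Proof. by elim: l w => [|l IH] // [u v] /= [hu ->]; rewrite -IH. Qed.

Lemma ext_deg_inj l s : ext_deg 0 (ext_inj l s).
Proof. by elim: l. Qed.

Lemma ext_degD i l (x y : ext l) : ext_deg i x -> ext_deg i y -> ext_deg i (x + y).
Proof.
elim: l i x y => [|l IH] [|i] //=.
- by move=> x y -> ->; rewrite addr0.
- by move=> [x1 x2] [y1 y2] /= [? ->] [? ->]; rewrite addr0; split=> //; apply: IH.
- by move=> [x1 x2] [y1 y2] /= [? ?] [? ?]; split; apply: IH.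
Qed.

Lemma ext_degZ i l p (x : ext l) : ext_deg i x -> ext_deg i (p *: x).
Proof.
elim: l i x => [|l IH] [|i] //=.
- by move=> x ->; rewrite scaler0.
- by move=> [x1 x2] /= [? ->]; rewrite scaler0; split=> //; apply: IH.
- by move=> [x1 x2] /= [? ?]; split; apply: IH.
Qed.

Lemma ext_deg0 i l : ext_deg i (0 : ext l).
Proof. by elim: l i => [|l IH] [|i] //=; split. Qed.

Lemma ext_degN i l (x : ext l) : ext_deg i x -> ext_deg i (- x).
Proof. by rewrite -scaleN1r; apply: ext_degZ. Qed.

Lemma kd_deg g i l (w : ext l) : ext_deg i.+1 w -> ext_deg i (kd g w).
Proof.
elim: l i w => [|l IH] i; first by move=> w _; exact: (@ext_deg0 i 0).
move=> [u v] /= [hu hv]; split; first by apply: ext_degD; [exact: IH | exact: ext_degZ].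
case: i hu hv => [|i] hu hv; last by apply: ext_degN; exact: IH.
suff -> : kd g v = 0 by rewrite oppr0.
elim: l v hv {IH u hu} => [|l IH] //= [u v] /= [hu ->].
by rewrite scaler0 addr0 IH // (lin0 (@kd_linear g l)) oppr0.
Qed.

Lemma kd_deg0 g l (w : ext l) : ext_deg 0 w -> kd g w = 0.
Proof.
elim: l w => [|l IH] //= [u v] /= [hu ->].
by rewrite scaler0 addr0 IH // (lin0 (@kd_linear g l)) oppr0.
Qed.

(** This makes [kd f] preserve the cycles of [kd g]: the cycles of the [y_i] form a complex under
    the differential of the [f_i]. *)
Lemma kd_anticomm f g l (w : ext l) : kd f (kd g w) = - kd g (kd f w).
Proof.
elim: l w => [|l IH] /=; first by rewrite oppr0.
move=> [u v]; rewrite -[RHS]/(- (kd g (kd f u + f l *: v) + g l *: - kd f v),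
  - - kd g (- kd f v)) /=.
congr pair; last by rewrite !(linN (@kd_linear _ l)) !opprK IH.
rewrite !(linD (@kd_linear _ l)) !(linZ (@kd_linear _ l)) IH !scalerN opprB.
by rewrite opprD addrCA addrA.
Qed.

Lemma kdK g l (w : ext l) : kd g (kd g w) = 0.
Proof.
elim: l w => [|l IH] //= [u v] /=.
rewrite (linD (@kd_linear _ l)) (linZ (@kd_linear _ l)) IH scalerN add0r subrr.
by rewrite (linN (@kd_linear _ l)) IH oppr0 oppr0.
Qed.

(** * Acyclicity of the Koszul complex of a regular sequence, modulo J *)

Section Exactness.
Variables (J : S -> Prop).
Hypothesis Jid : idealp J.

Lemma ext_all0 (Q : S -> Prop) l : Q 0 -> ext_all Q (0 : ext l).
Proof. by move=> Q0; elim: l. Qed.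

Lemma ext_allD (Q : S -> Prop) l (x y : ext l) :
  (forall p q, Q p -> Q q -> Q (p + q)) -> ext_all Q x -> ext_all Q y ->
  ext_all Q (x + y).
Proof.
move=> QD; elim: l x y => [|l IH] /=; first by move=> x y; exact: QD.
by move=> [x1 x2] [y1 y2] /= [? ?] [? ?]; split; apply: IH.
Qed.

Lemma ext_allZ (Q Q' : S -> Prop) l p (x : ext l) :
  (forall q, Q q -> Q' (p * q)) -> ext_all Q x -> ext_all Q' (p *: x).
Proof.
move=> QZ; elim: l x => [|l IH] /=; first by move=> x; exact: QZ.
by move=> [x1 x2] /= [? ?]; split; apply: IH.
Qed.

Lemma ext_all_imp (Q Q' : S -> Prop) l (x : ext l) :
  (forall q, Q q -> Q' q) -> ext_all Q x -> ext_all Q' x.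
Proof. by move=> h; elim: l x => [|l IH] /=; auto; move=> x [? ?]; auto. Qed.

Lemma ext_all_pr (Q : S -> Prop) l (x : ext l) : ext_all Q x -> Q (ext_pr x).
Proof. by elim: l x => [|l IH] //= x [h _]; exact: IH. Qed.

Lemma ext_all_inj (Q : S -> Prop) l s : Q 0 -> Q s -> ext_all Q (ext_inj l s).
Proof. by move=> Q0 Qs; elim: l => [|l IH] //=; split=> //; exact: ext_all0. Qed.

Lemma ext_all_kd (Q Q' : S -> Prop) g l (x : ext l) :
  Q' 0 -> (forall p q, Q' p -> Q' q -> Q' (p + q)) -> (forall p, Q' p -> Q' (- p)) ->
  (forall i q, Q q -> Q' (g i * q)) -> ext_all Q x -> ext_all Q' (kd g x).
Proof.
move=> Q0 QD QN Qg; elim: l x => [|l IH] //= x [h1 h2]; split.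
  by apply: ext_allD => //; [exact: IH | apply: ext_allZ h2; exact: Qg].
rewrite -scaleN1r; apply: ext_allZ (IH _ h2) => q; rewrite mulN1r; exact: QN.
Qed.

Lemma ext_idD l (x y : ext l) : ext_all J x -> ext_all J y -> ext_all J (x + y).
Proof. by apply: ext_allD; exact: (idD Jid). Qed.

Lemma ext_idZ l p (x : ext l) : ext_all J x -> ext_all J (p *: x).
Proof. by apply: ext_allZ; exact: (idM Jid). Qed.

Lemma ext_idN l (x : ext l) : ext_all J x -> ext_all J (- x).
Proof. by rewrite -scaleN1r; exact: ext_idZ. Qed.

Lemma ext_idB l (x y : ext l) : ext_all J x -> ext_all J y -> ext_all J (x - y).
Proof. by move=> ? ?; apply: ext_idD => //; apply: ext_idN. Qed.

Lemma ext_id0 l : ext_all J (0 : ext l).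
Proof. by apply: ext_all0; exact: (id0 Jid). Qed.

Lemma ext_id_kd g l (x : ext l) : ext_all J x -> ext_all J (kd g x).
Proof.
by apply: ext_all_kd => *; [exact: (id0 Jid) | exact: (idD Jid)
  | exact: (idN Jid) | exact: (idM Jid)].
Qed.

(** The ideal [J + (g_0, ..., g_(l-1))], with the last generator peeled off as in the recursion of
    [kd]. *)
Fixpoint in_gens (g : nat -> S) l (q : S) : Prop :=
  if l is l'.+1 then exists c, in_gens g l' (q - c * g l') else J q.

Lemma in_gens_idealp g l : idealp (in_gens g l).
Proof.
elim: l => [|l [h0 hD hM]] //=; split.
- by exists 0; rewrite mul0r subr0.
- move=> p q [c hc] [c' hc']; exists (c + c').
  by rewrite mulrDl opprD addrACA; exact: hD.
- by move=> r p [c hc]; exists (r * c); rewrite -mulrA -mulrBr; exact: hM.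
Qed.

Lemma in_gens_J g l q : J q -> in_gens g l q.
Proof.
by elim: l q => [|l IH] //= q h; exists 0; rewrite mul0r subr0; exact: IH.
Qed.

Lemma in_gens_le g l l' q : (l <= l')%N -> in_gens g l q -> in_gens g l' q.
Proof.
elim: l' => [|l' IH]; first by rewrite leqn0 => /eqP ->.
rewrite leq_eqVlt => /orP [/eqP -> //|h hq] /=.
by exists 0; rewrite mul0r subr0; exact: IH.
Qed.

Lemma in_gens_gen g l i : (i < l)%N -> in_gens g l (g i).
Proof.
move=> h; apply: (in_gens_le h) => /=; exists 1.
by rewrite mul1r subrr; exact: (id0 (in_gens_idealp g i)).
Qed.

Lemma in_gens_kd g l (w : ext l) : in_gens g l (ext_pr (kd g w)).
Proof.
elim: l w => [|l IH] /=; first by move=> _; exact: (id0 Jid).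
move=> [u v] /=; exists (ext_pr v).
rewrite (linD (@ext_pr_linear l)) (linZ (@ext_pr_linear l)) /GRing.scale /=.
by rewrite mulrC addrK.
Qed.

Lemma in_gens_lift g l q : in_gens g l q ->
  exists2 w : ext l, ext_deg 1 w & ext_all J (ext_inj l q - kd g w).
Proof.
elim: l q => [|l IH] /= q; first by exists 0; rewrite // subr0.
move=> [c /IH [w hw hJ]]; exists (w, ext_inj l c); first by split=> //; exact: ext_deg_inj.
split=> /=; first last.
  by rewrite opprK add0r kd_deg0; [exact: ext_id0 | exact: ext_deg_inj].
move: hJ; rewrite (linB (@ext_inj_linear l)) mulrC (linZ (@ext_inj_linear l)).
by rewrite -addrA -opprD [kd g w + _]addrC.
Qed.

(** Induction on [l]. For [w = (u, v)] the component [v] is a cycle, hence a boundary in positive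
    degree. In degree 0, [kd g u + g l *: v] being 0 modulo J puts [g l * v] in the ideal of the
    earlier generators; regularity puts [v] there, and so [v] is a boundary too. *)
Lemma kd_exact (g : nat -> S) l i (w : ext l) :
  (forall l' q, (l' < l)%N -> in_gens g l' (g l' * q) -> in_gens g l' q) ->
  ext_deg i.+1 w -> ext_all J (kd g w) ->
  exists2 w' : ext l, ext_deg i.+2 w' & ext_all J (w - kd g w').
Proof.
elim: l i w => [|l IH] i w reg.
  by move=> /= -> _; exists 0; rewrite // subrr; exact: (id0 Jid).
have reg' l' q : (l' < l)%N -> in_gens g l' (g l' * q) -> in_gens g l' q.
  by move=> h; apply: reg; exact: ltnW.
case: w => u v /= [hu hv] [ju jv].
have {}jv : ext_all J (kd g v) by rewrite -[kd g v]opprK; exact: ext_idN.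
have [v' hv' jv'] : exists2 v', ext_deg i.+1 v' & ext_all J (v - kd g v').
  case: i hu hv => [|i] hu hv; last exact: IH.
  rewrite (ext_deg0_inj hv) in ju *; apply: in_gens_lift; apply: reg => //.
  have := ext_all_pr ju.
  rewrite (linD (@ext_pr_linear l)) (linZ (@ext_pr_linear l)) ext_injK => h.
  rewrite -[g l * _](addKr (ext_pr (kd g u))) addrC.
  have [_ hD _] := in_gens_idealp g l; apply: hD; first exact: in_gens_J.
  by rewrite -mulN1r; apply: (idM (in_gens_idealp g l)); exact: in_gens_kd.
(* With [v] replaced by [kd g v'], the condition on the first component says that [u + g l *: v'] is
   a cycle. *)
have [||u' hu' ju'] := IH i (u + g l *: v') reg'.
- by apply: ext_degD => //; exact: ext_degZ.
- rewrite (linD (@kd_linear _ l)) (linZ (@kd_linear _ l)).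
  have -> : kd g u + g l *: kd g v' = kd g u + g l *: v - g l *: (v - kd g v').
    by rewrite scalerBr opprB [_ *: kd g v' - _]addrC addrA addrK.
  by apply: ext_idB => //; exact: ext_idZ.
exists (u', - v'); first by split=> //=; exact: ext_degN.
split=> /=; last by rewrite (linN (@kd_linear _ l)) opprK.
by rewrite scalerN opprB addrA.
Qed.

End Exactness.

(** Meant for projections [p] and [p'] onto bidegrees that differ by the bidegree of the [g i]: it
    extracts homogeneous preimages from arbitrary ones. *)
Lemma ext_map_kd (p p' : S -> S) g l (w : ext l) :
  {morph p : x y / x + y} -> {morph p : x / - x} -> p 0 = 0 ->
  (forall i q, p (g i * q) = g i * p' q) ->
  ext_map p (kd g w) = kd g (ext_map p' w).
Proof.
move=> pD pN p0 pg.
have mD l' (x y : ext l') : ext_map p (x + y) = ext_map p x + ext_map p y.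
  elim: l' x y => [|l' IH] /=; first exact: pD.
  by move=> [x1 x2] [y1 y2] /=; rewrite !IH.
have mN l' (x : ext l') : ext_map p (- x) = - ext_map p x.
  by elim: l' x => [|l' IH] /=; [exact: pN | move=> [x1 x2] /=; rewrite !IH].
have mg l' i (x : ext l') : ext_map p (g i *: x) = g i *: ext_map p' x.
  by elim: l' x => [|l' IH] /=; [exact: pg | move=> [x1 x2] /=; rewrite !IH].
by elim: l w => [|l IH] //= [u v] /=; rewrite mD mN mg !IH.
Qed.

End KoszulComplex.

(** * Bigraded polynomials *)

Section HomogeneousComponents.
Variables (R : comNzRingType) (n : nat).
Implicit Types p q : {mpoly R[n]}.

Lemma mcoeff_pihomog t p m :
  (pihomog mdeg t p)@_m = if mdeg m == t then p@_m else 0.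
Proof.
rewrite pihomogE raddf_sum /= big_mkcond /= [p in RHS]mpolyE raddf_sum /=.
case: ifP => hm; [apply: eq_bigr => m' _|apply: big1 => m' _];
  have [->|/negbTE ne] := eqVneq m' m; rewrite ?hm //;
  by case: ifP; rewrite // mcoeffZ mcoeffX ne mulr0.
Qed.

Lemma pihomog_mulr t u f p :
  f \is t.-homog -> pihomog mdeg (u + t) (f * p) = f * pihomog mdeg u p.
Proof.
move=> hf; rewrite [p in LHS](@pihomog_partitionE _ _ mdeg (mmeasure mdeg p)) //.
rewrite [p in RHS](@pihomog_partitionE _ _ mdeg (mmeasure mdeg p)) //.
rewrite mulr_sumr !raddf_sum mulr_sumr; apply: eq_bigr => i _ /=.
have hfp := dhomogM hf (pihomogP mdeg i p).
have [->|ne] := eqVneq u i; first by rewrite pihomog_id pihomog_dE // addnC.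
rewrite (pihomog_ne0 _ hfp) ?(pihomog_ne0 _ (pihomogP mdeg i p)) ?mulr0 //.
  by rewrite eq_sym.
by rewrite addnC eqn_add2r eq_sym.
Qed.

Lemma pihomog_mulr_lt t u f p :
  f \is t.-homog -> (u < t)%N -> pihomog mdeg u (f * p) = 0.
Proof.
move=> hf ht; rewrite (@pihomog_partitionE _ _ mdeg (mmeasure mdeg p) p) //.
rewrite mulr_sumr raddf_sum; apply: big1 => i _ /=.
rewrite (pihomog_ne0 _ (dhomogM hf (pihomogP mdeg i p))) //.
by apply/eqP => h; move: ht; rewrite -h ltnNge leq_addr.
Qed.

Lemma dhomogC0 (c : R) : c%:MP_[n] \is 0.-homog.
Proof.
apply/dhomogP => m; rewrite mcoeff_msupp mcoeffC.
have [->|ne] := eqVneq m 0%MM; first by move=> _; exact: mdeg0.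
by rewrite mulr0 eqxx.
Qed.

Lemma mcoeff_mulXU p (m : 'X_{1..n}) (i : 'I_n) : (m i = 0)%N -> (p * 'X_i)@_m = 0.
Proof.
move=> h; apply/eqP; rewrite mcoeff_eq0 (perm_mem (msuppMX p U_(i))).
apply/negP => /mapP [m' _ hm].
by move: h; rewrite hm mnmDE mnm1E eqxx.
Qed.

End HomogeneousComponents.

Section Bigraded.
Variables (K : fieldType) (n k : nat).
Local Notation P := {mpoly K[n]}.
Local Notation S := {mpoly P[k]}.
Implicit Types q : S.

(** [u] is the degree in the variables of [P], called x-degree below, and [j] the degree in the
    [y_i]. *)
Definition bihom (u j : nat) q := q \is j.-homog /\ forall m, q@_m \is u.-homog.

Definition bipr (u j : nat) q : S :=
  pihomog mdeg j (map_mpoly (pihomog mdeg u) q).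

Lemma mcoeff_bipr u j q m :
  (bipr u j q)@_m = if mdeg m == j then pihomog mdeg u q@_m else 0.
Proof. by rewrite /bipr mcoeff_pihomog mcoeff_map_mpoly. Qed.

Lemma biprD u j : {morph bipr u j : x y / x + y}.
Proof. by move=> x y; rewrite /bipr !raddfD. Qed.

Lemma biprN u j : {morph bipr u j : x / - x}.
Proof. by move=> x; rewrite /bipr !raddfN. Qed.

Lemma bipr0 u j : bipr u j 0 = 0.
Proof. by rewrite /bipr !raddf0. Qed.

Lemma bipr_bihom u j q : bihom u j (bipr u j q).
Proof.
split=> [|m]; first exact: pihomogP.
by rewrite mcoeff_bipr; case: ifP => _; [exact: pihomogP | exact: dhomog0].
Qed.

Lemma bihom_bipr u j q : bihom u j q -> bipr u j q = q.
Proof.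
move=> [hj hu]; apply/mpolyP => m; rewrite mcoeff_bipr.
case: ifP => hm; first by rewrite pihomog_dE.
by rewrite -(pihomog_dE hj) mcoeff_pihomog hm.
Qed.

Lemma bihom0 u j : bihom u j 0.
Proof. by split=> [|m]; rewrite ?mcoeff0; exact: dhomog0. Qed.

Lemma bihomD u j x y : bihom u j x -> bihom u j y -> bihom u j (x + y).
Proof. by move=> [? ?] [? ?]; split=> [|m]; rewrite ?mcoeffD; apply: rpredD. Qed.

Lemma bihomN u j x : bihom u j x -> bihom u j (- x).
Proof. by move=> [? ?]; split=> [|m]; rewrite ?mcoeffN -scaleN1r; apply: rpredZ. Qed.

Lemma bihomM u j u' j' x y :
  bihom u j x -> bihom u' j' y -> bihom (u + u') (j + j') (x * y).
Proof.
move=> [hx hx'] [hy hy']; split=> [|m]; first exact: dhomogM.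
by rewrite mcoeffM; apply: rpred_sum => i _; apply: dhomogM.
Qed.

Lemma bihomC u (p : P) : p \is u.-homog -> bihom u 0 p%:MP.
Proof.
move=> hp; split=> [|m]; first exact: dhomogC0.
by rewrite mcoeffC; case: eqP => _; rewrite ?mulr1 ?mulr0 //; exact: dhomog0.
Qed.

Lemma bihomX (m : 'X_{1..k}) : bihom 0 (mdeg m) 'X_[m].
Proof.
split=> [|m']; first by rewrite dhomogX.
by rewrite mcoeffX -mpolyC_nat; exact: dhomogC0.
Qed.

Lemma bihom00 q : bihom 0 0 q -> exists a : K, q = a%:MP%:MP.
Proof.
move=> [hq hc]; exists (q@_0)@_0.
have hq' : q = (q@_0)%:MP.
  apply/mpolyP => m; rewrite -(pihomog_dE hq) mcoeff_pihomog mcoeffC mdeg_eq0.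
  rewrite mcoeff_pihomog mdeg0 eqxx eq_sym.
  by case: eqP => [->|]; rewrite ?mulr1 ?mulr0.
rewrite {1}hq'; congr mpolyC.
apply/mpolyP => m; rewrite -(pihomog_dE (hc 0%MM)) mcoeff_pihomog mcoeffC mdeg_eq0.
rewrite mcoeff_pihomog mdeg0 eqxx eq_sym.
by case: eqP => [->|]; rewrite ?mulr1 ?mulr0.
Qed.

(* Indices are naturals to match [kd]; the value is 0 beyond k. *)
Definition ynat (l : nat) : S := if insub l is Some i then 'X_i else 0.

Lemma ynat_ord (i : 'I_k) : ynat i = 'X_i.
Proof. by rewrite /ynat valK. Qed.

Lemma ynatP (l : nat) : (exists2 i : 'I_k, l = i :> nat & ynat l = 'X_i) \/ ynat l = 0.
Proof.
rewrite /ynat; case: insubP => [i _ hi|_]; last by right.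
by left; exists i; rewrite -?hi.
Qed.

Lemma bihom_ynat u j l q : bihom u j q -> bihom u j.+1 (ynat l * q).
Proof.
move=> hq; have [[i _ ->]|->] := ynatP l; last by rewrite mul0r; exact: bihom0.
by rewrite -[u]add0n -add1n -[1%N](mdeg1 i); apply: bihomM => //; exact: bihomX.
Qed.

Lemma map_mulX u i q :
  map_mpoly (pihomog mdeg u) ('X_i * q) = 'X_i * map_mpoly (pihomog mdeg u) q :> S.
Proof.
apply/mpolyP => m; rewrite mcoeff_map_mpoly !mcoeffM raddf_sum /=.
apply: eq_bigr => m' _; rewrite mcoeffX !mulr_natl raddfMn mcoeff_map_mpoly.
by [].
Qed.

Lemma bipr_ynat u j l q : bipr u j.+1 (ynat l * q) = ynat l * bipr u j q.
Proof.
have [[i _ ->]|->] := ynatP l; last by rewrite !mul0r bipr0.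
by rewrite /bipr map_mulX -addn1 pihomog_mulr // dhomogX /= mdeg1.
Qed.

(** The value 0 is written as a product to fit the hypothesis of [ext_map_kd] with [p'] constantly
    0: there is no component of y-degree -1 to project onto. *)
Lemma bipr0_ynat u l q : bipr u 0 (ynat l * q) = ynat l * 0.
Proof.
have [[i _ ->]|->] := ynatP l; last by rewrite !mul0r bipr0.
by rewrite mulr0 /bipr map_mulX (pihomog_mulr_lt (t := 1)) // dhomogX /= mdeg1.
Qed.

Variables (J : P -> Prop) (d : nat) (f : 'I_k -> P).

Definition fP (l : nat) : P := if insub l is Some i then f i else 0.
Definition fnat (l : nat) : S := (fP l)%:MP.

Lemma fP_ord (i : 'I_k) : fP i = f i.
Proof. by rewrite /fP valK. Qed.

Definition coefJ q := forall m, J q@_m.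
(* The kernel of S -> A, y_i |-> f_i; on elements homogeneous in the y_i it agrees
   with the kernel of the map y_i |-> f_i t onto the Rees algebra. *)
Definition evJ q := J q.@[f].

Hypothesis f_homog : forall i, f i \is d.-homog.

Lemma fP_homog l : fP l \is d.-homog.
Proof. by rewrite /fP; case: insubP => [i _ _|_]; [exact: f_homog | exact: dhomog0]. Qed.

Lemma bihom_fnat u j l q : bihom u j q -> bihom (u + d) j (fnat l * q).
Proof.
move=> hq; rewrite addnC -[j]add0n.
by apply: bihomM => //; apply: bihomC; exact: fP_homog.
Qed.

Lemma map_mulC u l q :
  map_mpoly (pihomog mdeg (u + d)) (fnat l * q) =
  fnat l * map_mpoly (pihomog mdeg u) q :> S.
Proof.
apply/mpolyP => m; rewrite mcoeff_map_mpoly !mcoeffCM mcoeff_map_mpoly.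
by rewrite /= pihomog_mulr // fP_homog.
Qed.

Lemma bipr_fnat u j l q : bipr (u + d) j (fnat l * q) = fnat l * bipr u j q.
Proof. by rewrite /bipr map_mulC -[j]addn0 pihomog_mulr ?addn0 //; exact: dhomogC0. Qed.

Lemma bipr_fnat_lt u j l q : (u < d)%N -> bipr u j (fnat l * q) = fnat l * 0.
Proof.
move=> hu; apply/mpolyP => m; rewrite mcoeff_bipr mulr0 mcoeff0 mcoeffCM.
by rewrite (pihomog_mulr_lt _ (fP_homog l)) //; case: ifP.
Qed.

Hypothesis Jid : idealp J.
Hypothesis J_homog : homogeneous_ideal J.

Lemma coefJ_idealp : idealp coefJ.
Proof.
split=> [m|p q hp hq m|r p hp m].
- by rewrite mcoeff0; exact: (id0 Jid).
- by rewrite mcoeffD; exact: (idD Jid).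
- rewrite mcoeffM; elim/big_ind: _ => [|x y|i _].
  + exact: (id0 Jid).
  + exact: (idD Jid).
  + exact: (idM Jid).
Qed.

Lemma evJ_idealp : idealp evJ.
Proof.
split=> [|p q hp hq|r p hp]; rewrite /evJ.
- by rewrite meval0; exact: (id0 Jid).
- by rewrite mevalD; exact: (idD Jid).
- by rewrite mevalM; exact: (idM Jid).
Qed.

Lemma coefJ_evJ q : coefJ q -> evJ q.
Proof.
move=> h; rewrite /evJ mevalE; elim/big_ind: _ => [|x y|m _].
- exact: (id0 Jid).
- exact: (idD Jid).
- by rewrite mulrC; exact: (idM Jid).
Qed.

Lemma coefJ_bipr u j q : coefJ q -> coefJ (bipr u j q).
Proof.
move=> h m; rewrite mcoeff_bipr; case: ifP => _; last exact: (id0 Jid).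
exact: J_homog.
Qed.

Lemma coefJC (p : P) : J p -> coefJ p%:MP.
Proof.
by move=> h m; rewrite mcoeffC mulrC; exact: (idM Jid).
Qed.

Lemma idealp_monomials (I : S -> Prop) q :
  idealp I -> (forall m, I (q@_m *: 'X_[m])) -> I q.
Proof.
move=> Iid h; rewrite [q]mpolyE.
by elim/big_ind: _ => [|x y|m _]; [exact: (id0 Iid) | exact: (idD Iid) |].
Qed.

(** Reduces regularity of the [y_l] to coefficients: multiplication by [y_l] only shifts the
    monomials free of the earlier variables. *)
Lemma in_gens_ynat l q : in_gens coefJ ynat l q <->
  forall m : 'X_{1..k}, (forall i : 'I_k, (i < l)%N -> (m i = 0)%N) -> J q@_m.
Proof.
split.
  elim: l q => [|l IH] q /=; first by move=> h m _; exact: h.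
  move=> [c hc] m hm; have := IH _ hc m (fun i hi => hm i (ltnW hi)).
  rewrite mcoeffB; have [[i hi ->]|->] := ynatP l; last by rewrite mulr0 mcoeff0 subr0.
  by rewrite mcoeff_mulXU ?subr0 //; apply: hm; rewrite hi.
move=> h; have Iid := in_gens_idealp coefJ_idealp ynat l.
apply: idealp_monomials => // m.
have [[i hi hm]|hm] := classic (exists2 i : 'I_k, (i < l)%N & (m i <> 0)%N).
  have -> : m = (m - U_(i) + U_(i))%MM by rewrite submK // lep1mP; apply/eqP.
  rewrite mpolyXD -mul_mpolyC mulrA -ynat_ord; apply: (idM Iid).
  exact: (in_gens_gen coefJ_idealp).
apply: (@in_gens_J _ _); rewrite -mul_mpolyC mulrC.
apply: (idM coefJ_idealp); apply: coefJC; apply: h => i hi.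
by apply: NNPP => hmi; apply: hm; exists i.
Qed.

Lemma ynat_regular l q : (l < k)%N ->
  in_gens coefJ ynat l (ynat l * q) -> in_gens coefJ ynat l q.
Proof.
move=> hl /in_gens_ynat h; apply/in_gens_ynat => m hm.
have := h (m + U_(Ordinal hl))%MM.
rewrite -[l]/(nat_of_ord (Ordinal hl)) ynat_ord mulrC addmC mcoeffMX; apply.
move=> i hi; rewrite mnmDE mnm1E hm // addn0.
by case: eqP hi => // <-; rewrite ltnn.
Qed.

Lemma in_gens_fP l (p : P) :
  in_gens J fP l p <-> in_ideal_mod J (fun j : 'I_k => (j < l)%N) f p.
Proof.
elim: l p => [|l IH] p /=; rewrite /in_ideal_mod.
  split=> [h|[c]]; first by exists (fun=> 0); rewrite big_pred0 ?subr0.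
  by rewrite big_pred0 ?subr0.
have [hl|hl] := ltnP l k; last first.
  have -> : fP l = 0 by rewrite /fP insubF // ltnNge hl.
  have e (c : 'I_k -> P) : \sum_(i < k | (i < l.+1)%N) c i * f i =
      \sum_(i < k | (i < l)%N) c i * f i.
    by apply: eq_bigl => i; rewrite !(leq_trans (ltn_ord i)) // ltnW.
  split=> [[c]|[c]]; first by rewrite mulr0 subr0 => /IH [a]; exists a; rewrite e.
  by rewrite e => h; exists 0; rewrite mul0r subr0; apply/IH; exists c.
pose il := Ordinal hl.
have e (c : 'I_k -> P) : \sum_(i < k | (i < l.+1)%N) c i * f i =
    c il * f il + \sum_(i < k | (i < l)%N) c i * f i.
  rewrite (bigD1 il) //=; congr (_ + _); apply: eq_bigl => i.
  by rewrite ltnS [in RHS]ltn_neqAle andbC.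
have -> : fP l = f il by rewrite -[l]/(nat_of_ord il) fP_ord.
split=> [[c /IH [a ha]]|[c]].
  exists (fun i => if i == il then c else a i).
  rewrite e eqxx opprD addrA (eq_bigr (fun i => a i * f i)) // => i.
  by case: eqP => // ->; rewrite ltnn.
rewrite e => h; exists (c il); apply/IH; exists c.
by rewrite -addrA -opprD.
Qed.

Lemma in_gens_fnatC l (p : P) : in_gens J fP l p -> in_gens coefJ fnat l p%:MP.
Proof.
elim: l p => [|l IH] p /=; first exact: coefJC.
by move=> [c /IH h]; exists c%:MP; rewrite -mpolyCM -mpolyCB.
Qed.

(** Membership is tested coefficient by coefficient, so regularity of [f] passes from A to A[y]. *)
Lemma in_gens_fnat l q :
  in_gens coefJ fnat l q <-> forall m, in_gens J fP l q@_m.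
Proof.
split.
  elim: l q => [|l IH] q //= [c hc] m; exists c@_m.
  by have := IH _ hc m; rewrite mcoeffB mulrC mcoeffCM mulrC.
move=> h; have Iid := in_gens_idealp coefJ_idealp fnat l.
apply: idealp_monomials => // m.
by rewrite -mul_mpolyC mulrC; apply: (idM Iid); exact: in_gens_fnatC.
Qed.

Hypothesis f_regular : regular_seq J f.

Lemma fnat_regular l q : (l < k)%N ->
  in_gens coefJ fnat l (fnat l * q) -> in_gens coefJ fnat l q.
Proof.
move=> hl /in_gens_fnat h; apply/in_gens_fnat => m.
apply/in_gens_fP; apply: (f_regular.1 (Ordinal hl)); apply/in_gens_fP.
by rewrite -(fP_ord (Ordinal hl)) -mcoeffCM; exact: h.
Qed.

End Bigraded.

Section ExteriorMaps.
Variable S : comNzRingType.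

Lemma ext_deg_gt i l (w : ext S l) : (l < i)%N -> ext_deg i w -> w = 0.
Proof.
elim: l i w => [|l IH] [|i] //=; first by case=> u v /= hl [/(IH _ _ (ltnW hl)) -> /(IH _ _ hl) ->].
Qed.

Lemma ext_pr_deg i l (w : ext S l) : ext_deg i.+1 w -> ext_pr w = 0.
Proof. by elim: l w => [|l IH] //= w [hw _]; exact: IH. Qed.

Lemma ext_pr_kdS g l (w : ext S l.+1) :
  ext_pr (kd g w) = ext_pr (kd g w.1) + g l * ext_pr w.2.
Proof. by rewrite [LHS](linD (@ext_pr_linear _ l)) (linZ (@ext_pr_linear _ l)). Qed.

Lemma ext_map_deg h i l (w : ext S l) : h 0 = 0 -> ext_deg i w ->
  ext_deg i (ext_map h w).
Proof.
move=> h0; have hm0 l' : ext_map h (0 : ext S l') = 0.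
  by elim: l' => [|l' IH] //=; rewrite IH.
elim: l i w => [|l IH] [|i] //=; first by move=> w ->.
  by case=> u v /= [hu ->]; rewrite hm0; split=> //; exact: IH.
by case=> u v /= [hu hv]; split; exact: IH.
Qed.

Lemma ext_map_id h (Q : S -> Prop) l (w : ext S l) :
  (forall q, Q q -> h q = q) -> ext_all Q w -> ext_map h w = w.
Proof.
by move=> hQ; elim: l w => [|l IH] /=; [exact: hQ | case=> u v /= [? ?]; rewrite !IH].
Qed.

Lemma ext_map_all h (Q Q' : S -> Prop) l (w : ext S l) :
  (forall q, Q q -> Q' (h q)) -> ext_all Q w -> ext_all Q' (ext_map h w).
Proof.
by move=> hQ; elim: l w => [|l IH] /=; [exact: hQ | case=> u v /= [? ?]; split; exact: IH].
Qed.

Lemma ext_all_True l (w : ext S l) : ext_all (fun=> True) w.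
Proof. by elim: l w => [|l IH] //=. Qed.

Lemma ext_mapB h l (x y : ext S l) : {morph h : x y / x + y} ->
  {morph h : x / - x} -> ext_map h (x - y) = ext_map h x - ext_map h y.
Proof.
move=> hD hN; elim: l x y => [|l IH] /=; first by move=> x y; rewrite hD hN.
by case=> x1 x2 [y1 y2] /=; rewrite !IH.
Qed.

Lemma ext_map_zero l (w : ext S l) : ext_map (fun=> 0) w = 0.
Proof. by elim: l w => [|l IH] //= [a b] /=; rewrite !IH. Qed.

End ExteriorMaps.

(** * Bigraded exactness, and the complex of Koszul cycles *)

Section GradedExactness.
Variables (K : fieldType) (n k : nat).
Local Notation P := {mpoly K[n]}.
Local Notation S := {mpoly P[k]}.
Variables (J : P -> Prop) (d : nat) (f : 'I_k -> P).
Hypothesis f_homog : forall i, f i \is d.-homog.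
Hypothesis Jid : idealp J.
Hypothesis J_homog : homogeneous_ideal J.
Hypothesis f_regular : regular_seq J f.

Local Notation cJ := (@coefJ K n k J).
Local Notation E := (ext S k).
Local Notation dy := (kd (@ynat K n k)).
Local Notation df := (kd (fnat f)).
Let cid : idealp cJ := coefJ_idealp k Jid.

Lemma ext_all_bihom_kdy u j (w : E) :
  ext_all (bihom u j) w -> ext_all (bihom u j.+1) (dy w).
Proof.
apply: ext_all_kd; [exact: bihom0 | exact: bihomD | exact: bihomN|].
by move=> i q; exact: bihom_ynat.
Qed.

Lemma ext_all_bihom_kdf u j (w : E) :
  ext_all (bihom u j) w -> ext_all (bihom (u + d) j) (df w).
Proof.
apply: ext_all_kd; [exact: bihom0 | exact: bihomD | exact: bihomN|].
by move=> i q; exact: bihom_fnat.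
Qed.

(** [0 < i + j] excludes exterior degree 0 with y-degree 0, the only place where the Koszul complex
    of the [y_i] has homology. A preimage has y-degree [j - 1], so for [j = 0] the cycle itself
    vanishes modulo J. *)
Lemma dy_exact u j i (z : E) :
  ext_deg i z -> ext_all (bihom u j) z -> (0 < i + j)%N -> ext_all cJ (dy z) ->
  if j is j'.+1 then
    exists2 v : E, ext_deg i.+1 v /\ ext_all (bihom u j') v & ext_all cJ (z - dy v)
  else ext_all cJ z.
Proof.
move=> hi hz hij hc.
have [w hw hwc] : exists2 w : E, ext_deg i.+1 w & ext_all cJ (z - dy w).
  case: i hi hij => [|i] hi hij; last first.
    by apply: kd_exact => // l q hl; exact: ynat_regular.
  rewrite (ext_deg0_inj hi); apply: in_gens_lift => //; apply/in_gens_ynat => // m hm.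
  have [hj _] := ext_all_pr hz; rewrite -(pihomog_dE hj) mcoeff_pihomog.
  have -> : m = 0%MM by apply/mnmP => a; rewrite mnm0E; apply: hm.
  rewrite mdeg0; case: eqP hij => [<- //|_ _]; exact: (id0 Jid).
have hmap p' : (forall l q, bipr u j (ynat K n k l * q) = ynat K n k l * p' q) ->
    ext_all cJ (z - dy (ext_map p' w)).
  move=> hp'.
  rewrite -(ext_map_kd w (@biprD _ _ _ u j) (@biprN _ _ _ u j) (bipr0 _ _ _ u j) hp').
  rewrite -{1}(ext_map_id (@bihom_bipr _ _ _ u j) hz).
  rewrite -(ext_mapB _ _ (@biprD _ _ _ u j) (@biprN _ _ _ u j)).
  by apply: ext_map_all hwc => q; exact: coefJ_bipr.
case: j hz hij hmap => [|j] hz hij hmap.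
  have := hmap (fun=> 0) (fun l q => bipr0_ynat u l q).
  by rewrite ext_map_zero (lin0 (@kd_linear _ _ k)) subr0.
exists (ext_map (bipr u j) w); last by apply: hmap => l q; exact: bipr_ynat.
split; first by apply: ext_map_deg => //; exact: bipr0.
by apply: ext_map_all (ext_all_True w) => q _; exact: bipr_bihom.
Qed.

(** Subtraction of naturals truncates, so the case [u < d], where no preimage of x-degree [u - d]
    exists, is kept apart as [v = 0]. *)
Lemma df_exact u j i (z : E) :
  ext_deg i.+1 z -> ext_all (bihom u j) z -> ext_all cJ (df z) ->
  exists2 v : E, ext_deg i.+2 v /\
    (v = 0 \/ (d <= u)%N /\ ext_all (bihom (u - d) j) v) & ext_all cJ (z - df v).
Proof.
move=> hi hz hc.
have [w hw hwc] : exists2 w : E, ext_deg i.+2 w & ext_all cJ (z - df w).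
  by apply: kd_exact => // l q hl; exact: fnat_regular.
have hmap p' : (forall l q, bipr u j (fnat f l * q) = fnat f l * p' q) ->
    ext_all cJ (z - df (ext_map p' w)).
  move=> hp'.
  rewrite -(ext_map_kd w (@biprD _ _ _ u j) (@biprN _ _ _ u j) (bipr0 _ _ _ u j) hp').
  rewrite -{1}(ext_map_id (@bihom_bipr _ _ _ u j) hz).
  rewrite -(ext_mapB _ _ (@biprD _ _ _ u j) (@biprN _ _ _ u j)).
  by apply: ext_map_all hwc => q; exact: coefJ_bipr.
have [hu|hu] := leqP d u.
  exists (ext_map (bipr (u - d) j) w).
    split; first by apply: ext_map_deg => //; exact: bipr0.
    right; split=> //.
    by apply: ext_map_all (ext_all_True w) => q _; exact: bipr_bihom.
  by apply: hmap => l q; rewrite -{1}(subnK hu); exact: bipr_fnat.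
exists 0; first by split; [exact: ext_deg0 | left].
have := hmap (fun=> 0) (fun l q => bipr_fnat_lt f_homog j l q hu).
by rewrite ext_map_zero.
Qed.

(** The last clause is the augmentation: in exterior degree 0, where both differentials vanish, it
    puts [z] in the kernel of evaluation; in positive degrees [ext_pr z] is 0. One predicate thus
    covers the whole augmented complex. *)
Definition bicycle (z : E) :=
  [/\ ext_all cJ (dy z), ext_all cJ (df z) & evJ J f (ext_pr z)].

(** Evaluation identifies [y_i] with [f_i], hence the two differentials into degree 0. Consequently
    [df] sends [dy]-cycles of degree 1 into the kernel of evaluation. *)
Lemma ev_ext_pr_kd (w : E) : (ext_pr (dy w)).@[f] = (ext_pr (df w)).@[f].
Proof.
suff H l (v : ext S l) : (l <= k)%N ->
  (ext_pr (kd (@ynat K n k) v)).@[f] = (ext_pr (kd (fnat f) v)).@[f] by exact: H.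
elim: l v => [|l IH] v hl; first by rewrite /= !meval0.
have evalD (x p y : S) : (x + p * y).@[f] = x.@[f] + p.@[f] * y.@[f].
  by rewrite mevalD mevalM.
have step h : (ext_pr (kd h v)).@[f] =
    (ext_pr (kd h v.1)).@[f] + (h l).@[f] * (ext_pr v.2).@[f].
  by rewrite ext_pr_kdS; exact: evalD.
apply: etrans (step _) (etrans _ (esym (step _))).
congr (_ + _ * _); first exact: IH (ltnW hl).
rewrite -[l]/(nat_of_ord (Ordinal hl)) ynat_ord mevalXU /fnat mevalC.
by rewrite fP_ord.
Qed.

(* Exactness of the Eagon-Northcott-type complex (ker dy, df), by induction on
   the y-degree: if z = dy v then df v is again a bicycle, of smaller y-degree. *)
Lemma bicycle_exact j : forall u i (z : E),
  ext_deg i z -> ext_all (bihom u j) z -> bicycle z ->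
  exists w : E, [/\ ext_deg i.+1 w, ext_all cJ (dy w), ext_all cJ (z - df w) &
    w = 0 \/ (d <= u)%N /\ ext_all (bihom (u - d) j) w].
Proof.
have lin_dy := @kd_linear S (@ynat K n k) k.
have lin_df := @kd_linear S (fnat f) k.
elim: j => [|j IH] u i z hi hz [zy zf ze].
  suff zc : ext_all cJ z.
    exists 0; split; first exact: ext_deg0.
    - by rewrite (lin0 lin_dy); exact: ext_id0.
    - by rewrite (lin0 lin_df) subr0.
    - by left.
  case: i hi => [|i] hi; last by have := dy_exact hi hz (ltn0Sn _) zy.
  rewrite (ext_deg0_inj hi); apply: ext_all_inj; first exact: (id0 cid).
  have [hq _] := ext_all_pr hz; move: ze; rewrite /evJ.
  have -> : ext_pr z = ((ext_pr z)@_0)%:MP.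
    apply/mpolyP => m; rewrite -{1}(pihomog_dE hq) mcoeff_pihomog mcoeffC mdeg_eq0 eq_sym.
    by rewrite eq_sym; case: eqP => [->|]; rewrite ?mulr1 ?mulr0.
  by rewrite mevalC; exact: coefJC.
have [|v [hv hvb] hvz] := dy_exact hi hz _ zy; first by rewrite addnS.
have dvz : ext_all cJ (dy (df v)).
  rewrite kd_anticomm; apply: ext_idN => //.
  have -> : df (dy v) = df z - df (z - dy v) by rewrite (linB lin_df) subKr.
  by apply: ext_idB => //; exact: ext_id_kd.
have [|w' [hw' w'y w'f w'b]] := IH (u + d)%N i (df v) (kd_deg _ hv) (ext_all_bihom_kdf hvb).
  split=> //; first by rewrite kdK; exact: ext_id0.
  rewrite /evJ -ev_ext_pr_kd.
  have -> : ext_pr (dy v) = (ext_pr z : S) - ext_pr (z - dy v) :> S.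
    by rewrite (linB (@ext_pr_linear _ k)) (subKr (ext_pr z : S^o)).
  rewrite mevalB; apply: (idB Jid) => //.
  by apply: coefJ_evJ => //; exact: ext_all_pr hvz.
have {}w'b : ext_all (bihom u j) w'.
  case: w'b => [->|[_]]; last by rewrite addnK.
  by apply: ext_all0; exact: bihom0.
have [|||u' [hu' u'b] u'f] := @df_exact u j i (v - w').
- by apply: ext_degD => //; exact: ext_degN.
- apply: ext_allD => //; first exact: bihomD.
  by rewrite -scaleN1r; apply: ext_allZ w'b => q; rewrite mulN1r; exact: bihomN.
- by rewrite (linB lin_df).
(* Modulo J one has [z = dy v], [v = w' + df u'] and [dy w' = 0], so anticommutation gives
   [z = df (- dy u')]. *)
exists (- dy u'); split.
- by apply: ext_degN; exact: kd_deg.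
- by rewrite (linN lin_dy) kdK oppr0; exact: ext_id0.
- rewrite (linN lin_df) opprK.
  have -> : z + df (dy u') = (z - dy v) + dy (v - w' - df u') + dy w'.
    rewrite (kd_anticomm (fnat f)) !(linB lin_dy) -!addrA; congr (_ + _).
    by rewrite addKr [- dy (df u') + _]addrC addKr.
  by apply: ext_idD => //; apply: ext_idD => //; exact: ext_id_kd.
- case: u'b => [->|[hd hb]]; first by left; rewrite (lin0 lin_dy) oppr0.
  right; split=> //; rewrite -scaleN1r; apply: ext_allZ (ext_all_bihom_kdy hb) => q.
  by rewrite mulN1r; exact: bihomN.
Qed.

(** The preimage [w] is a [dy]-cycle of exterior degree at least [k], hence modulo J the boundary of
    an element of degree above [k], which is zero. So the resolution by cycles stops and only
    finitely many degree bounds arise. *)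
Lemma bicycle_top u j i (z : E) : (k <= i.+1)%N -> ext_deg i z ->
  ext_all (bihom u j) z -> bicycle z -> ext_all cJ z.
Proof.
move=> hk hi hz /(bicycle_exact hi hz) [w [hw wy wf _]].
have [w' hw' hww'] := kd_exact cid (fun l q (hl : (l < k)%N) => ynat_regular Jid hl (q := q)) hw wy.
have w'0 : w' = 0 by apply: ext_deg_gt hw'; rewrite ltnS.
have wc : ext_all cJ w.
  by move: hww'; rewrite w'0 (lin0 (@kd_linear _ _ k)) subr0.
by rewrite -[z](subrK (df w)); apply: ext_idD => //; exact: ext_id_kd.
Qed.

End GradedExactness.

Lemma subrowE (R : zmodType) r (v w : 'rV[R]_r) b : (v - w) 0 b = v 0 b - w 0 b.
Proof. by rewrite !mxE. Qed.

(** * The linear resolution of K over A, extended to polynomials in the y_i *)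

Section Resolution.
Variables (K : fieldType) (n k : nat).
Local Notation P := {mpoly K[n]}.
Local Notation S := {mpoly P[k]}.
Variable J : P -> Prop.
Hypothesis Jid : idealp J.
Hypothesis J_homog : homogeneous_ideal J.
Local Notation cJ := (@coefJ K n k J).
Let cid : idealp cJ := coefJ_idealp k Jid.

Definition homog_row u r (v : 'rV[P]_r) := forall a, v 0 a \is u.-homog.

Lemma pihomog_row_mul u r1 r2 (v : 'rV[P]_r1) (D : 'M[P]_(r1, r2)) b :
  (forall a b, D a b \is 1.-homog) ->
  pihomog mdeg u.+1 ((v *m D) 0 b) = (map_mx (pihomog mdeg u) v *m D) 0 b.
Proof.
move=> hD; rewrite !mxE raddf_sum; apply: eq_bigr => a _ /=.
by rewrite mxE mulrC -addn1 pihomog_mulr // mulrC.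
Qed.

Lemma pihomog0_row_mul r1 r2 (v : 'rV[P]_r1) (D : 'M[P]_(r1, r2)) b :
  (forall a b, D a b \is 1.-homog) -> pihomog mdeg 0 ((v *m D) 0 b) = 0.
Proof.
move=> hD; rewrite mxE raddf_sum; apply: big1 => a _ /=.
by rewrite mulrC (pihomog_mulr_lt _ (hD a b)).
Qed.

Lemma homog_sub u (x y : P) : x \is u.-homog ->
  J (x - y) -> J (x - pihomog mdeg u y).
Proof. by move=> hx /(@J_homog _)/(_ u); rewrite raddfB /= pihomog_dE. Qed.

Lemma mcoeff_bsum b (F : 'X_{1..k} -> P) m :
  (\sum_(m' : 'X_{1..k < b}) F m' *: 'X_[m'] : S)@_m =
  if (mdeg m < b)%N then F m else 0.
Proof.
rewrite raddf_sum /=; case: ifP => hm.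
  rewrite (bigD1 (BMultinom hm)) //= mcoeffZ mcoeffX eqxx mulr1 big1 ?addr0 //.
  move=> m' hm'; rewrite mcoeffZ mcoeffX; case: eqP => [e|]; last by rewrite mulr0.
  by case/eqP: hm'; apply: val_inj.
apply: big1 => m' _; rewrite mcoeffZ mcoeffX; case: eqP => [e|]; last by rewrite mulr0.
by move: (bmdeg m'); rewrite e hm.
Qed.

(** Assembles a row of y-degree [j] from one choice per monomial; this carries exactness from A to
    A[y]. *)
Lemma coefwise_choice j r (Q : 'X_{1..k} -> 'rV[P]_r -> Prop) :
  (forall m, mdeg m = j -> exists x, Q m x) ->
  exists w : 'rV[S]_r,
    forall m, if mdeg m == j then Q m (map_mx (mcoeff m) w)
              else map_mx (mcoeff m) w = 0.
Proof.
move=> h.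
have [F hF] : exists F : 'X_{1..k} -> 'rV[P]_r,
    forall m, if mdeg m == j then Q m (F m) else F m = 0.
  have hex m : exists x : 'rV[P]_r, if mdeg m == j then Q m x else x = 0.
    by case: eqP => hm; [exact: h | exists 0].
  exists (fun m => proj1_sig (constructive_indefinite_description _ (hex m))).
  by move=> m; exact: (proj2_sig (constructive_indefinite_description _ (hex m))).
pose w : 'rV[S]_r := \row_a \sum_(m' : 'X_{1..k < j.+1}) F m' 0 a *: 'X_[m'].
exists w => m.
suff -> : map_mx (mcoeff m) w = F m by exact: hF.
apply/rowP => a; rewrite !mxE (mcoeff_bsum j.+1 (fun m => F m 0 a)).
case: ltnP => // hm; have := hF m.
by case: eqP => [e|_ ->]; [rewrite e ltnn in hm | rewrite mxE].
Qed.

Lemma map_mcoeff_mul m r1 r2 (v : 'rV[S]_r1) (D : 'M[P]_(r1, r2)) :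
  map_mx (mcoeff m) (v *m map_mx (mpolyC k (R:=P)) D) = map_mx (mcoeff m) v *m D.
Proof.
apply/rowP => b; rewrite !mxE raddf_sum; apply: eq_bigr => a _ /=.
by rewrite !mxE mulrC mcoeffCM mulrC.
Qed.

Lemma bihom_mdeg u j (q : S) m : bihom u j q -> mdeg m != j -> q@_m = 0.
Proof. by move=> [hj _] /negbTE h; rewrite -(pihomog_dE hj) mcoeff_pihomog h. Qed.

Lemma bihom_coef u j (q : S) :
  (forall m, if mdeg m == j then is_true (q@_m \is u.-homog) else q@_m = 0) -> bihom u j q.
Proof.
move=> h; split=> [|m].
  apply/dhomogP => m; rewrite mcoeff_msupp => hm; apply/eqP.
  by have := h m; case: ifP => // _ h0; rewrite h0 eqxx in hm.
by have := h m; case: ifP => // _ ->; exact: dhomog0.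
Qed.

Variables (r : nat -> nat) (d0 : 'M[P]_(r 0%N, 1))
  (dn : forall i : nat, 'M[P]_(r i.+1, r i)).
Hypothesis hd0 : forall a b, d0 a b \is 1.-homog.
Hypothesis hdn : forall i a b, dn i a b \is 1.-homog.
Hypothesis hdd0 : forall a b, J ((dn 0 *m d0) a b).
Hypothesis hddn : forall i a b, J ((dn i.+1 *m dn i) a b).
Hypothesis ex0 : forall p : P, mcoeff 0%MM p = 0 ->
  exists v : 'rV[P]_(r 0%N), J (p - (v *m d0) 0 0).
Hypothesis ex1 : forall v : 'rV[P]_(r 0%N), J ((v *m d0) 0 0) ->
  exists w : 'rV[P]_(r 1%N), forall j, J ((v - w *m dn 0) 0 j).
Hypothesis exn : forall i (v : 'rV[P]_(r i.+1)), (forall j, J ((v *m dn i) 0 j)) ->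
  exists w : 'rV[P]_(r i.+2), forall j, J ((v - w *m dn i.+1) 0 j).

(** Absorbs the separate first differential [d0], so that syzygies of all orders are treated
    uniformly. *)
Definition res_cycle i : 'rV[P]_(r i) -> Prop :=
  match i return 'rV[P]_(r i) -> Prop with
  | 0 => fun v => entries J (v *m d0)
  | i'.+1 => fun v => entries J (v *m dn i')
  end.

Lemma res_cycle_ex i (v : 'rV[P]_(r i)) :
  res_cycle v -> exists w : 'rV[P]_(r i.+1), entries J (v - w *m dn i).
Proof. by case: i v => [|i] v hv; [apply: ex1 | apply: exn]. Qed.

Lemma res_cycle_dn i (w : 'rV[P]_(r i.+1)) : res_cycle (w *m dn i).
Proof.
have H r1 r2 r3 (D1 : 'M[P]_(r1, r2)) (D2 : 'M[P]_(r2, r3)) (v : 'rV[P]_r1) :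
    (forall a b, J ((D1 *m D2) a b)) -> entries J (v *m D1 *m D2).
  move=> h b; rewrite -mulmxA mxE.
  by elim/big_ind: _ => [|x y|a _]; [exact: (id0 Jid) | exact: (idD Jid) | exact: (idM Jid)].
by case: i w => [|i] w; exact: H.
Qed.

(** Exactness in [koszul] is ungraded. Since the matrices are linear and J is homogeneous, the
    component of degree [u] of a preimage is still a preimage. *)
Lemma res_homog_ex0 u (p : P) : p \is u.+1.-homog ->
  exists2 v : 'rV[P]_(r 0%N), homog_row u v & J (p - (v *m d0) 0 0).
Proof.
move=> hp; have [|v hv] := ex0 (p := p).
  by rewrite -(pihomog_dE hp) mcoeff_pihomog mdeg0.
exists (map_mx (pihomog mdeg u) v); first by move=> a; rewrite mxE; exact: pihomogP.
by rewrite -pihomog_row_mul //; exact: homog_sub.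
Qed.

Lemma res_homog_ex i u (v : 'rV[P]_(r i)) : homog_row u.+1 v -> res_cycle v ->
  exists2 w : 'rV[P]_(r i.+1), homog_row u w & entries J (v - w *m dn i).
Proof.
move=> hv /res_cycle_ex [w hw].
exists (map_mx (pihomog mdeg u) w); first by move=> a; rewrite mxE; exact: pihomogP.
move=> b; rewrite 2!mxE -pihomog_row_mul //; apply: homog_sub => //.
by have := hw b; rewrite 2!mxE.
Qed.

Lemma res_homog_ex_zero i (v : 'rV[P]_(r i)) : homog_row 0 v -> res_cycle v ->
  entries J v.
Proof.
move=> hv /res_cycle_ex [w hw] b; have := hw b; rewrite 2!mxE => /(homog_sub (hv b)).
by rewrite pihomog0_row_mul // subr0.
Qed.

Definition d0S : 'M[S]_(r 0%N, 1) := map_mx (mpolyC k (R:=P)) d0.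
Definition dnS i : 'M[S]_(r i.+1, r i) := map_mx (mpolyC k (R:=P)) (dn i).

Definition bihom_row u j r (v : 'rV[S]_r) := forall a, bihom u j (v 0 a).

Definition res_cycleS i (v : 'rV[S]_(r i)) :=
  forall m, res_cycle (map_mx (mcoeff m) v).

Lemma bihom_row_coef u j r' (v : 'rV[S]_r') m :
  bihom_row u j v -> homog_row u (map_mx (mcoeff m) v).
Proof. by move=> h a; rewrite mxE; case: (h a). Qed.

Lemma bihom_row_of_coef u j r' (v : 'rV[S]_r') :
  (forall m, if mdeg m == j then homog_row u (map_mx (mcoeff m) v)
             else map_mx (mcoeff m) v = 0) -> bihom_row u j v.
Proof.
move=> h a; apply: bihom_coef => m; have := h m.
case: ifP => _; first by move=> /(_ a); rewrite mxE.
by move=> /rowP /(_ a); rewrite !mxE.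
Qed.

Lemma bihom_row_mul u j r1 r2 (v : 'rV[S]_r1) (D : 'M[P]_(r1, r2)) :
  (forall a b, D a b \is 1.-homog) -> bihom_row u j v ->
  bihom_row u.+1 j (v *m map_mx (mpolyC k (R:=P)) D).
Proof.
move=> hD hv b; rewrite mxE.
elim/big_ind: _ => [|x y|a _]; [exact: bihom0 | exact: bihomD |].
by rewrite mxE -addn1 -[j]addn0; apply: bihomM => //; exact: bihomC.
Qed.

Lemma resS_ex0 u j (q : S) : bihom u.+1 j q ->
  exists2 v : 'rV[S]_(r 0%N), bihom_row u j v & cJ (q - (v *m d0S) 0 0).
Proof.
move=> hq.
have [w hw] := @coefwise_choice j _ (fun m x => homog_row u x /\ J (q@_m - (x *m d0) 0 0))
  (fun m _ => let: ex_intro2 v h1 h2 := res_homog_ex0 (hq.2 m) in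
     ex_intro _ v (conj h1 h2)).
exists w; first by apply: bihom_row_of_coef => m; have := hw m; case: ifP => // _ [].
move=> m; have := hw m; rewrite mcoeffB.
have -> : ((w *m d0S) 0 0)@_m = (map_mx (mcoeff m) w *m d0) 0 0.
  by rewrite -map_mcoeff_mul [RHS]mxE.
case: ifP => [_ []//|/negbT hm ->].
by rewrite mul0mx mxE (bihom_mdeg hq hm) subrr; exact: (id0 Jid).
Qed.

Lemma resS_ex i u j (v : 'rV[S]_(r i)) : bihom_row u.+1 j v -> res_cycleS v ->
  exists2 w : 'rV[S]_(r i.+1), bihom_row u j w & entries cJ (v - w *m dnS i).
Proof.
move=> hv hc.
have [w hw] := @coefwise_choice j _ (fun m x => homog_row u x /\
    entries J (map_mx (mcoeff m) v - x *m dn i))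
  (fun m _ => let: ex_intro2 x h1 h2 :=
     res_homog_ex (bihom_row_coef m hv) (hc m) in ex_intro _ x (conj h1 h2)).
exists w; first by apply: bihom_row_of_coef => m; have := hw m; case: ifP => // _ [].
move=> b m; have := hw m; rewrite subrowE mcoeffB.
have -> : ((w *m dnS i) 0 b)@_m = (map_mx (mcoeff m) w *m dn i) 0 b.
  by rewrite -map_mcoeff_mul [RHS]mxE.
case: ifP => [_ [_ /(_ b)]|/negbT hm ->]; first by rewrite subrowE mxE.
by rewrite mul0mx mxE (bihom_mdeg (hv b) hm) subrr; exact: (id0 Jid).
Qed.

Lemma resS_ex_zero i j (v : 'rV[S]_(r i)) : bihom_row 0 j v -> res_cycleS v ->
  entries cJ v.
Proof.
move=> hv hc b m; have := res_homog_ex_zero (bihom_row_coef m hv) (hc m) b.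
by rewrite mxE.
Qed.

Lemma res_cycleS0 (v : 'rV[S]_(r 0%N)) : res_cycleS v <-> cJ ((v *m d0S) 0 0).
Proof.
split=> h m.
  by have := h m 0; rewrite -map_mcoeff_mul mxE.
by move=> b; rewrite -map_mcoeff_mul mxE (ord1 b); exact: h.
Qed.

Lemma res_cycleSn i (v : 'rV[S]_(r i.+1)) :
  res_cycleS v <-> entries cJ (v *m dnS i).
Proof.
split=> h => [b m|m b].
  by have := h m b; rewrite -map_mcoeff_mul mxE.
by rewrite -map_mcoeff_mul mxE; exact: h.
Qed.

Lemma res_cycleS_dn i (w : 'rV[S]_(r i.+1)) : res_cycleS (w *m dnS i).
Proof. by move=> m; rewrite map_mcoeff_mul; exact: res_cycle_dn. Qed.

Lemma res_cycleSP i (v w : 'rV[S]_(r i)) p :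
  res_cycleS v -> res_cycleS w -> res_cycleS (p *: v + w).
Proof.
case: i v w => [|i] v w.
  move=> /res_cycleS0 hv /res_cycleS0 hw; apply/res_cycleS0.
  rewrite mulmxDl -scalemxAl 2!mxE; apply: (idD cid) => //; exact: (idM cid).
move=> /res_cycleSn hv /res_cycleSn hw; apply/res_cycleSn => b.
have -> : ((p *: v + w) *m dnS i) 0 b =
    p * (v *m dnS i) 0 b + (w *m dnS i) 0 b.
  by rewrite mulmxDl -scalemxAl 2!mxE.
exact: (idD cid (idM cid p (hv b)) (hw b)).
Qed.

End Resolution.

(** * Diagonals of shifted modules *)

Section Diagonal.
Variables (K : fieldType) (n k : nat).
Local Notation P := {mpoly K[n]}.
Local Notation S := {mpoly P[k]}.
Variables (J : P -> Prop) (d : nat) (f : 'I_k -> P).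
Hypothesis f_homog : forall i, f i \is d.-homog.
Hypothesis Jid : idealp J.
Hypothesis J_homog : homogeneous_ideal J.
Hypothesis f_regular : regular_seq J f.
Hypothesis J_koszul : koszul J.
Variables (c e : nat).
Hypothesis e_gt0 : (0 < e)%N.

Local Notation cJ := (@coefJ K n k J).
Let cid : idealp cJ := coefJ_idealp k Jid.
Local Notation dy := (@kd S (@ynat K n k) k).
Local Notation df := (@kd S (fnat f) k).

Definition diag (s : nat) : S -> Prop := bihom (c * s) (e * s).

Lemma diag_grading : grading diag.
Proof.
have b1 : bihom 0 0 (1 : S) by rewrite -mpolyC1; apply: bihomC; exact: dhomog1.
split=> [s|s p q|t s p q hp hq||].
- exact: bihom0.
- exact: bihomD.
- by rewrite /diag !mulnDr; exact: bihomM.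
- by rewrite /diag !muln0.
- by rewrite /diag !muln0; exact: bihomN.
Qed.

Let Ggr := diag_grading.

(* The shift of S by (a, b), restricted to the diagonal. *)
Definition shifted (a b s : nat) : S^o -> Prop := bihom (c * s + a) (e * s + b).

Lemma shiftedM a b t s (p q : S) : diag t p -> shifted a b s q ->
  shifted a b (t + s) (p * q).
Proof. by move=> hp hq; rewrite /shifted !mulnDr -!addnA; exact: bihomM. Qed.

Lemma shifted_S a b s (q : S) : shifted a b s.+1 q = shifted (a + c) (b + e) s q.
Proof. by rewrite /shifted !mulnS; congr bihom; lia. Qed.

Lemma gmod_shifted a b : gmod diag cJ (shifted a b) (fun _ => cJ).
Proof.
split=> [s|s x y|t s p x|s|s x y|t s p x _|t s p x hp _ _].
- exact: bihom0.
- exact: bihomD.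
- exact: shiftedM.
- exact: (id0 cid).
- exact: (idD cid).
- exact: (idM cid).
- by rewrite /GRing.scale /= mulrC; exact: (idM cid).
Qed.

Definition ext_diag l i a b s (w : ext S l) :=
  ext_deg i w /\ ext_all (shifted a b s) w.

Lemma gmod_ext_diag l i a b :
  gmod diag cJ (@ext_diag l i a b) (fun _ => ext_all cJ (l := l)).
Proof.
split=> [s|s x y [? ?] [? ?]|t s p x hp [? hx]|s|s x y|t s p x _|t s p x hp _ _].
- by split; [exact: ext_deg0 | apply: ext_all0; exact: bihom0].
- by split; [exact: ext_degD | apply: ext_allD => //; exact: bihomD].
- by split; [exact: ext_degZ | apply: ext_allZ hx => q; exact: shiftedM].
- exact: ext_id0.
- exact: ext_idD.
- exact: ext_idZ.
- apply: ext_allZ (ext_all_True x) => q _.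
  by rewrite mulrC; exact: (idM cid).
Qed.

Lemma Lin_ext_diag m a b : Lin diag cJ m (shifted a b) (fun _ => cJ) ->
  forall l i, Lin diag cJ m (@ext_diag l i a b) (fun _ => ext_all cJ (l := l)).
Proof.
move=> L; elim=> [|l IH] i.
  case: i => [|i]; last first.
    by apply: Lin_zero => s z [/= -> _]; exact: (id0 cid).
  apply: (Lin_ext Ggr cid (gmod_shifted a b) _ _ L) => // s z.
  by split=> [|[]].
case: i => [|i].
  apply: (Lin_iso (f := fun u : ext S l => (u, 0) : ext S l.+1) Ggr cid
    (gmod_ext_diag l 0 a b) (gmod_ext_diag l.+1 0 a b) _ _ _ _ (IH 0%N)).
  - move=> p x y; rewrite -[RHS]/(p *: x + y, p *: 0 + 0).
    by rewrite scaler0 addr0.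
  - by move=> s z [? ?]; split; split=> //=; apply: ext_all0; exact: bihom0.
  - by move=> s z _; split=> [[]|h] //; split=> //=; exact: (ext_id0 cid l).
  - move=> s [u v] [[/= hu ->] [hu2 _]]; exists u => //.
    by split=> /=; rewrite subrr; exact: (ext_id0 cid l).
apply: (Lin_extension (f' := fun u : ext S l => (u, 0) : ext S l.+1)
  (f := fun w : ext S l.+1 => w.2) Ggr cid _ (IH i.+1) (IH i)).
split; try exact: gmod_ext_diag.
- move=> p x y; rewrite -[RHS]/(p *: x + y, p *: 0 + 0).
  by rewrite scaler0 addr0.
- by move=> p [x1 x2] [y1 y2].
- by move=> s z [? ?]; split; split=> //=; [exact: ext_deg0 | apply: ext_all0; exact: bihom0].
- by move=> s z _; split=> [[]|h] //; split=> //=; exact: (ext_id0 cid l).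
- by move=> s [u v] [[? ?] [? ?]].
- by move=> s [u v] _ [].
- move=> s v [? ?]; exists (0, v); last by rewrite /= subrr; exact: (ext_id0 cid l).
  by split; split=> //=; [exact: ext_deg0 | apply: ext_all0; exact: bihom0].
- by move=> s z _ /=; exact: (ext_id0 cid l).
- move=> s [u v] [[? ?] [? ?]] /= hv; exists u => //.
  by split=> /=; rewrite ?subr0 // subrr; exact: (ext_id0 cid l).
Qed.

Definition cycles i a b s (w : ext S k) :=
  ext_diag i a b s w /\ ext_all cJ (dy w).

Definition bicycles i a b s (w : ext S k) :=
  ext_diag i a b s w /\ bicycle J f w.

Local Notation extJ := (fun _ : nat => ext_all cJ (l := k)).

Lemma gmod_cycles i a b : gmod diag cJ (cycles i a b) extJ.
Proof.
apply: gmod_restrict; first exact: gmod_ext_diag.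
- by move=> s; rewrite (lin0 (@kd_linear _ _ k)); exact: ext_id0.
- by move=> s x y _ _ hx hy; rewrite (linD (@kd_linear _ _ k)); exact: ext_idD.
- by move=> t s p x _ _ hx; rewrite (linZ (@kd_linear _ _ k)); exact: ext_idZ.
Qed.

Lemma gmod_bicycles i a b : gmod diag cJ (bicycles i a b) extJ.
Proof.
apply: gmod_restrict; first exact: gmod_ext_diag.
- move=> s; split; rewrite ?(lin0 (@kd_linear _ _ k)); try exact: ext_id0.
  by rewrite (lin0 (@ext_pr_linear _ k)); exact: (id0 (evJ_idealp f Jid)).
- move=> s x y _ _ [? ? ?] [? ? ?]; split; rewrite ?(linD (@kd_linear _ _ k)); try exact: ext_idD.
  by rewrite (linD (@ext_pr_linear _ k)); exact: (idD (evJ_idealp f Jid)).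
- move=> t s p x _ _ [? ? ?]; split; rewrite ?(linZ (@kd_linear _ _ k)); try exact: ext_idZ.
  by rewrite (linZ (@ext_pr_linear _ k)); exact: (idM (evJ_idealp f Jid)).
Qed.

Lemma ext_diag_S i a b s w :
  @ext_diag k i a b s.+1 w <-> @ext_diag k i (a + c) (b + e) s w.
Proof.
by split=> [] [? h]; split=> //; apply: ext_all_imp h => q; rewrite shifted_S.
Qed.

Lemma ext_diag_dy i a b s (w : ext S k) :
  ext_diag i.+1 a b s w -> ext_diag i a b.+1 s (dy w).
Proof.
move=> [hd h]; split; first exact: kd_deg.
by rewrite /shifted addnS; exact: ext_all_bihom_kdy.
Qed.

Section Step.
Variable m : nat.
Hypothesis IHcycles : forall m', m = m'.+1 ->
  forall i a b, Lin diag cJ m' (cycles i a b.+1) extJ.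

(** [dy] maps exterior degree [i + 1] onto these cycles: the shift [b.+1] keeps the y-degree
    positive, away from the homology. The kernel again consists of cycles, and truncation raises its
    y-shift by [e > 0], back to the form of a successor. *)
Lemma Lin_cycles_step i a b : Lin diag cJ m (shifted a b) (fun _ => cJ) ->
  Lin diag cJ m (cycles i a b.+1) extJ.
Proof.
move=> L; apply: (Lin_quotient (f := dy) Ggr cid (gmod_ext_diag k i.+1 a b)
  (gmod_cycles i a b.+1) (@kd_linear _ _ k) _ _ _ (Lin_ext_diag L k i.+1)).
- move=> s w hw; split; first exact: ext_diag_dy.
  by rewrite kdK; exact: ext_id0.
- by move=> s w _; exact: ext_id_kd.
- move=> s z [[hd h] hz]; move: h; rewrite /shifted addnS => h.
  have [|v [? ?] ?] := dy_exact Jid J_homog hd h _ hz; first by rewrite addnS.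
  by exists v.
- move=> m' hm; have := IHcycles hm i.+1 (a + c) (b + e).-1.
  rewrite prednK ?addn_gt0 ?e_gt0 ?orbT // => L'.
  apply: (Lin_ext Ggr cid (gmod_cycles _ _ _) _ _ L') => // s w.
  by split=> [] [/ext_diag_S ? ?].
Qed.

(** In exterior degree 0 every element is a cycle, so [cycles 0 a b.+1] is the shifted module
    itself. *)
Lemma Lin_shifted_step_y a b : Lin diag cJ m (shifted a b) (fun _ => cJ) ->
  Lin diag cJ m (shifted a b.+1) (fun _ => cJ).
Proof.
move=> L; have L0 := Lin_cycles_step 0 L.
apply: (Lin_iso (f := @ext_pr S k : _ -> S^o) Ggr cid (gmod_cycles _ _ _)
  (gmod_shifted _ _) (@ext_pr_linear _ k) _ _ _ L0).
- by move=> s w [[_ h] _]; exact: ext_all_pr h.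
- move=> s w [[hd _] _]; split=> [h|]; last exact: ext_all_pr.
  by rewrite (ext_deg0_inj hd); apply: ext_all_inj => //; exact: (id0 cid).
- move=> s q hq; exists (ext_inj k q); last by rewrite ext_injK subrr; exact: (id0 cid).
  have hd := ext_deg_inj k q; split; last by rewrite kd_deg0 //; exact: ext_id0.
  by split=> //; apply: ext_all_inj => //; exact: bihom0.
Qed.

Variables (r : nat -> nat) (d0 : 'M[P]_(r 0%N, 1))
  (dn : forall i : nat, 'M[P]_(r i.+1, r i)).
Hypothesis hd0 : forall a b, d0 a b \is 1.-homog.
Hypothesis hdn : forall i a b, dn i a b \is 1.-homog.
Hypothesis hdd0 : forall a b, J ((dn 0 *m d0) a b).
Hypothesis hddn : forall i a b, J ((dn i.+1 *m dn i) a b).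
Hypothesis ex0 : forall p : P, mcoeff 0%MM p = 0 ->
  exists v : 'rV[P]_(r 0%N), J (p - (v *m d0) 0 0).
Hypothesis ex1 : forall v : 'rV[P]_(r 0%N), J ((v *m d0) 0 0) ->
  exists w : 'rV[P]_(r 1%N), forall j, J ((v - w *m dn 0) 0 j).
Hypothesis exn : forall i (v : 'rV[P]_(r i.+1)), (forall j, J ((v *m dn i) 0 j)) ->
  exists w : 'rV[P]_(r i.+2), forall j, J ((v - w *m dn i.+1) 0 j).

Definition syzygies i a b s (v : 'rV[S]_(r i)) :=
  (forall j, shifted a b s (v 0 j)) /\ res_cycleS J d0 dn v.

Local Notation rowJ i := (fun _ : nat => @entries S cJ (r i)).

Lemma gmod_syzygies i a b : gmod diag cJ (@syzygies i a b) (rowJ i).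
Proof.
apply: gmod_restrict; first exact: (gmod_row (r i) (gmod_shifted a b)).
- by move=> s mm; rewrite map_mx0; case: (i) => [|i'] j; rewrite mul0mx mxE; exact: (id0 Jid).
- by move=> s x y _ _ hx hy; rewrite -[x]scale1r; exact: res_cycleSP.
- move=> t s p x _ _ hx; rewrite -[_ *: _]addr0; apply: res_cycleSP => //.
  by move=> mm; rewrite map_mx0; case: (i) => [|i'] j; rewrite mul0mx mxE; exact: (id0 Jid).
Qed.

(** For [a = 0 < c] the degree 0 component has x-degree 0, where cycles vanish modulo J, so it
    cannot generate later components. For [a = c = 0] the whole module vanishes. *)
Hypothesis IHsyz : forall m', m = m'.+1 ->
  forall i a b, (0 < a)%N || (c == 0)%N -> Lin diag cJ m' (@syzygies i a b) (rowJ i).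

Lemma Lin_syzygies_shift m' i a b : m = m'.+1 ->
  Lin diag cJ m' (fun s (v : 'rV[S]_(r i)) =>
    (forall j, shifted a b s.+1 (v 0 j)) /\ res_cycleS J d0 dn v) (rowJ i).
Proof.
(* Truncation turns the x-shift into [a + c], for which the side condition holds whatever [a] is. *)
move=> hm; have h : (0 < a + c)%N || (c == 0)%N by lia.
apply: (Lin_ext Ggr cid (gmod_syzygies i _ _) _ _ (IHsyz hm i (b + e) h)) => // s v.
by split=> [] [h1 h2]; split=> // j; have := h1 j; rewrite shifted_S.
Qed.

Lemma Lin_shifted_step_x a b : Lin diag cJ m (shifted a b) (fun _ => cJ) ->
  Lin diag cJ m (shifted a.+1 b) (fun _ => cJ).
Proof.
move=> L; apply: (Lin_quotient (f := fun v : 'rV[S]_(r 0%N) => (v *m d0S k d0) 0 0 : S^o)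
  Ggr cid (gmod_row (r 0%N) (gmod_shifted a b)) (gmod_shifted a.+1 b) _ _ _ _
  (Lin_row Ggr cid (r 0%N) (gmod_shifted a b) L)).
- by move=> p x y; rewrite mulmxDl -scalemxAl 2!mxE.
- by move=> s v hv; rewrite /shifted addnS; exact: (bihom_row_mul hd0 hv).
- by move=> s v _ hv; exact: (idealp_mulmx cid).
- move=> s q; rewrite /shifted addnS => /(resS_ex0 Jid J_homog hd0 ex0) [v hv hq].
  by exists v.
- move=> m' hm.
  apply: (Lin_ext Ggr cid (gmod_shift (gmod_syzygies 0 a b)) _ _
    (Lin_syzygies_shift 0 a b hm)) => // s v.
  by split=> [] [? /res_cycleS0 ?]; split=> //; exact/res_cycleS0.
Qed.

Lemma Lin_syzygies_step i a b : Lin diag cJ m (shifted a b) (fun _ => cJ) ->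
  Lin diag cJ m (@syzygies i a.+1 b) (rowJ i).
Proof.
move=> L; apply: (Lin_quotient (f := fun v : 'rV[S]_(r i.+1) => v *m dnS k dn i)
  Ggr cid (gmod_row (r i.+1) (gmod_shifted a b)) (gmod_syzygies i a.+1 b) _ _ _ _
  (Lin_row Ggr cid (r i.+1) (gmod_shifted a b) L)).
- by move=> p x y; rewrite mulmxDl -scalemxAl.
- move=> s v hv; split; last exact: res_cycleS_dn.
  by rewrite /shifted addnS; exact: (bihom_row_mul (@hdn i) hv).
- by move=> s v _ hv; exact: (idealp_mulmx cid).
- move=> s v [hv hc]; move: hv; rewrite /shifted addnS => hv.
  by have [w hw ?] := resS_ex Jid J_homog hdn ex1 exn hv hc; exists w.
- move=> m' hm.
  apply: (Lin_ext Ggr cid (gmod_shift (gmod_syzygies i.+1 a b)) _ _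
    (Lin_syzygies_shift i.+1 a b hm)) => // s v.
  by split=> [] [? /res_cycleSn ?]; split=> //; exact/res_cycleSn.
Qed.

End Step.

(** Strong induction on [m] for shifts of S, Koszul cycles and syzygies at once: each map used has a
    source built from shifts already treated and a kernel needed only to order [m - 1]. All shifts
    are reached from [(0, 0)], raising first [b] through the [y_i], then [a] through the resolution
    of K. *)
Lemma Lin_shifted_cycles m :
  (forall a b, Lin diag cJ m (shifted a b) (fun _ => cJ)) /\
  (forall i a b, Lin diag cJ m (cycles i a b.+1) extJ).
Proof.
have [r [d0 [dn [hd0 [hdn [hdd0 [hddn [ex0 [ex1 exn]]]]]]]]] := J_koszul.
suff H : [/\ forall a b, Lin diag cJ m (shifted a b) (fun _ => cJ),
   forall i a b, Lin diag cJ m (cycles i a b.+1) extJ &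
   forall i a b, (0 < a)%N || (c == 0)%N ->
     Lin diag cJ m (@syzygies r d0 dn i a b) (fun _ => @entries S cJ (r i))].
  by have [? ? _] := H.
elim/ltn_ind: m => m IH.
have IHc m' : m = m'.+1 -> forall i a b, Lin diag cJ m' (cycles i a b.+1) extJ.
  by move=> hm; have [|_ h _] := IH m'; rewrite ?hm.
have IHs m' : m = m'.+1 -> forall i a b, (0 < a)%N || (c == 0)%N ->
    Lin diag cJ m' (@syzygies r d0 dn i a b) (fun _ => @entries S cJ (r i)).
  by move=> hm; have [|_ _ h] := IH m'; rewrite ?hm.
have L0 b : Lin diag cJ m (shifted 0 b) (fun _ => cJ).
  elim: b => [|b IHb]; last exact: Lin_shifted_step_y.
  apply: (Lin_ext Ggr cid (gmod_ring Ggr cid) _ _ (Lin_free Ggr cid m)) => // s q.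
  by rewrite /shifted !addn0.
have L a b : Lin diag cJ m (shifted a b) (fun _ => cJ).
  by elim: a => [|a IHa] //; exact: (Lin_shifted_step_x hd0 ex0 IHs).
split=> // [i a b|i [|a] b].
- exact: Lin_cycles_step.
- move=> /= /eqP c0; apply: Lin_zero => s v [hv hc].
  apply: (resS_ex_zero (j := (e * s + b)%N) J_homog hdn ex1 exn _ hc) => j.
  by have := hv j; rewrite /shifted c0 mul0n addn0.
- by move=> _; exact: (Lin_syzygies_step hdn hdd0 hddn ex1 exn IHs).
Qed.

(** [df] maps cycles of exterior degree [i + 1] and x-shift [a - d] onto these bicycles, and the
    truncated kernel consists of bicycles of degree [i + 1] and x-shift [a - d + c]. The inequality
    for [p] says that after [p] such passages the x-shift is still at least [d]; [bicycle_top]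
    bounds the range of [p]. *)
Lemma Lin_bicycles m : forall i a b,
  (forall p, (i + p.+1 < k)%N -> (p.+1 * d <= a + p * c)%N) ->
  Lin diag cJ m (bicycles i a b.+1) extJ.
Proof.
elim/ltn_ind: m => m IH i a b hab; have [hk|hk] := leqP k i.+1.
  apply: Lin_zero => s z [[hd hz] hb].
  exact: (bicycle_top f_homog Jid J_homog f_regular hk hd hz hb).
have da : (d <= a)%N by have := hab 0%N; rewrite addn1 mul1n mul0n addn0; exact.
apply: (Lin_quotient (f := df) Ggr cid (gmod_cycles i.+1 (a - d) b.+1)
  (gmod_bicycles i a b.+1) (@kd_linear _ _ k) _ _ _
  ((Lin_shifted_cycles _).2 i.+1 (a - d)%N b)) => //.
- move=> s w [[hd h] hw]; split.
    split; first exact: kd_deg.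
    by rewrite /shifted -(subnK da) addnA; exact: ext_all_bihom_kdf.
  split; last by rewrite /evJ -ev_ext_pr_kd; apply: coefJ_evJ => //; exact: ext_all_pr.
    by rewrite kd_anticomm; apply: ext_idN => //; exact: ext_id_kd.
  by rewrite kdK; exact: ext_id0.
- by move=> s w _; exact: ext_id_kd.
- move=> s z [[hd hz] hb].
  have [w [hw wy wf wb]] := bicycle_exact f_homog Jid J_homog f_regular hd hz hb.
  exists w => //; split=> //; split=> //.
  case: wb => [->|[_]]; first by apply: ext_all0; exact: bihom0.
  by rewrite /shifted addnBA.
move=> m' hm.
have hab' p : (i.+1 + p.+1 < k)%N -> (p.+1 * d <= a - d + c + p * c)%N.
  by move=> hp; have := hab p.+1; rewrite addSnnS in hp => /(_ hp); nia.
have L := IH m' _ i.+1 (a - d + c)%N (b + e)%N hab'; rewrite hm in L.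
apply: (Lin_ext Ggr cid (gmod_bicycles _ _ _) _ _ (L (ltnSn _))) => // s w.
have hS := ext_diag_S i.+1 (a - d) b.+1 s w; split.
  by move=> [/hS hw [wy wf _]].
move=> [[/hS hw wy] wf]; split=> //; split=> //.
by rewrite (ext_pr_deg hw.1); exact: (id0 (evJ_idealp f Jid)).
Qed.

Lemma diag_shift t s : diag (t + s) = shifted (t * c) (t * e) s.
Proof. by rewrite /diag /shifted ![in LHS]mulnDr; congr bihom; lia. Qed.

Hypothesis k_gt0 : (0 < k)%N.
Hypothesis hc : (d * (k - 1) <= c * k)%N.

(** As [t >= 2], it suffices that [(p + 1) d <= (p + 2) c]. The ratio [(p + 1) / (p + 2)] increases
    with [p] and equals [(k - 1) / k] at [p = k - 2], the case given by [hc]. *)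
Lemma degree_bound p t : (2 <= t)%N -> (p.+1 < k)%N -> (p.+1 * d <= t * c + p * c)%N.
Proof.
move=> ht hp; apply: (@leq_trans ((p + 2) * c)%N); last by nia.
rewrite -(leq_pmul2r k_gt0).
have A : (p.+1 * k <= (k - 1) * (p + 2))%N by nia.
have B := leq_mul (leqnn d) A; have C := leq_mul hc (leqnn (p + 2)).
have {C} := leq_trans B (leq_trans (eq_leq (mulnA _ _ _)) C); lia.
Qed.

Let evid : idealp (evJ J f) := evJ_idealp f Jid.

Lemma gmod_diag (J0 : S -> Prop) t : idealp J0 ->
  gmod diag J0 (fun s => diag (t + s) : S^o -> Prop) (fun _ => J0).
Proof.
move=> J0id; have [Z0 ZD ZM B0 BD BM BJ] := gmod_ring Ggr J0id.
split=> // [s x y|u s p x|u s p x hp hG hx]; first exact: ZD.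
  by rewrite addnCA; exact: ZM.
exact: (BJ u (t + s)%N).
Qed.

Lemma gmod_ker t : gmod diag cJ (fun s (q : S^o) => diag (t + s) q /\ evJ J f q)
  (fun _ => cJ).
Proof.
apply: gmod_restrict.
- exact: gmod_diag.
- by move=> _; exact: (id0 evid).
- by move=> s x y _ _; exact: (idD evid).
- by move=> ? s p x _ _; exact: (idM evid).
Qed.

(** The kernel of evaluation in degrees >= [t] of the diagonal is the module of bicycles of exterior
    degree 0, with x-shift [t c] and y-shift [t e]. *)
Lemma Lin_ker t m : (2 <= t)%N ->
  Lin diag cJ m (fun s (q : S^o) => diag (t + s) q /\ evJ J f q) (fun _ => cJ).
Proof.
move=> ht; have te : (t * e = (t * e).-1.+1)%N by rewrite prednK ?muln_gt0 ?e_gt0 ?andbT; lia.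
have L := @Lin_bicycles m 0 (t * c) (t * e).-1 (fun p => @degree_bound p t ht).
apply: (Lin_iso (f := @ext_pr S k : _ -> S^o) Ggr cid (gmod_bicycles _ _ _)
  (gmod_ker t) (@ext_pr_linear _ k) _ _ _ L).
- move=> s w [[_ h] [_ _ he]]; split=> //.
  by rewrite diag_shift te; exact: ext_all_pr h.
- move=> s w [[hd _] _]; split=> [h|]; last exact: ext_all_pr.
  by rewrite (ext_deg0_inj hd); apply: ext_all_inj => //; exact: (id0 cid).
- move=> s q [hq he]; exists (ext_inj k q); last by rewrite ext_injK subrr; exact: (id0 cid).
  have hd := ext_deg_inj k q; split; last first.
    by split; rewrite ?kd_deg0 ?ext_injK //; exact: ext_id0.
  split=> //; apply: ext_all_inj; first exact: bihom0.
  by rewrite diag_shift te in hq.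
Qed.

(** Linearity over T comes first: the module is the quotient of a shift of S by a kernel whose
    truncation starts in degree [t + 1 >= 2]. [Lin_ker] in degree 2 then permits the change of
    rings. *)
Lemma Lin_rees t m : (0 < t)%N ->
  Lin diag (evJ J f) m (fun s => diag (t + s) : S^o -> Prop) (fun _ => evJ J f).
Proof.
move=> ht; have cev := coefJ_evJ f Jid.
have M2 : gmod diag (evJ J f) (fun s => diag (t + s) : S^o -> Prop) (fun _ => evJ J f).
  exact: gmod_diag.
have M : gmod diag cJ (fun s => diag (t + s) : S^o -> Prop) (fun _ => cJ).
  exact: gmod_diag.
apply: (Lin_change_of_rings Ggr cid evid cev _ M2).
  by move=> i; exact: (@Lin_ker 2 i).
apply: (Lin_quotient (f := id) Ggr cid M (gmod_weaken cev M2)) => //.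
- by move=> s q _; exact: cev.
- by move=> s q hq; exists q => //; rewrite subrr; exact: (id0 evid).
- apply: (Lin_ext Ggr cid (gmod_shifted (t * c) (t * e)) _ _
    ((Lin_shifted_cycles m).1 (t * c)%N (t * e)%N)) => // s q.
  by rewrite diag_shift.
- move=> m' _; apply: (Lin_ext Ggr cid (gmod_ker t.+1) _ _ (@Lin_ker t.+1 m' _)) => // s q.
  by rewrite addnS.
Qed.

End Diagonal.

(** * Presentation by a basis of (I^e)_(ed+c) *)

(** Bridges monomials in the [y_i] and [pow_gens], which indexes the generators of [I^e] by
    functions. *)
Lemma mnm_prod_ffun (R : comNzRingType) k (h : 'I_k -> R) e (m : 'X_{1..k}) :
  mdeg m = e ->
  exists s : {ffun 'I_e -> 'I_k}, \prod_i h i ^+ m i = \prod_(j < e) h (s j).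
Proof.
elim: e m => [|e IH] m hm.
  have -> : m = 0%MM by apply/eqP; rewrite -mdeg_eq0 hm.
  exists (ffun0 (card_ord 0)); rewrite big_ord0 big1 // => i _.
  by rewrite mnm0E expr0.
have [i hi] : exists i, m i != 0%N.
  apply: NNPP => hn; suff m0 : m = 0%MM by move: hm; rewrite m0 mdeg0.
  apply/mnmP => i; rewrite mnm0E; apply/eqP; apply: NNPP => hmi.
  by apply: hn; exists i; apply/negP.
have hmi : m = (m - U_(i) + U_(i))%MM by rewrite submK // lep1mP.
have [|s hs] := IH (m - U_(i))%MM.
  by apply/eqP; rewrite -eqSS -hm {2}hmi mdegD mdeg1 addn1.
exists [ffun j => if unlift ord0 j is Some j' then s j' else i].
rewrite big_ord_recl ffunE unlift_none.
under [X in _ = _ * X]eq_bigr => j _ do rewrite ffunE liftK.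
rewrite -hs {1}hmi.
rewrite (eq_bigr (fun a => h a ^+ (m - U_(i))%MM a * h a ^+ U_(i)%MM a)); last first.
  by move=> a _; rewrite mnmDE exprD.
rewrite big_split /= mulrC; congr (_ * _).
rewrite (bigD1 i) //= mnm1E eqxx expr1 big1 ?mulr1 // => a ha.
by rewrite mnm1E eq_sym (negbTE ha) expr0.
Qed.

Section IdealMod.
Variables (K : fieldType) (n : nat) (J : {mpoly K[n]} -> Prop).
Hypothesis Jid : idealp J.

Lemma in_ideal_mod_idealp (I : finType) (g : I -> {mpoly K[n]}) :
  idealp (in_ideal_mod J predT g).
Proof.
split.
- exists (fun=> 0); rewrite big1 ?subr0; first exact: (id0 Jid).
  by move=> i _; rewrite mul0r.
- move=> p q [a ha] [b hb]; exists (fun i => a i + b i).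
  have -> : \sum_(i | predT i) (a i + b i) * g i =
     \sum_(i | predT i) a i * g i + \sum_(i | predT i) b i * g i.
    by rewrite -big_split; apply: eq_bigr => i _; rewrite mulrDl.
  by rewrite opprD addrACA; exact: (idD Jid).
- move=> r p [a ha]; exists (fun i => r * a i).
  have -> : \sum_(i | predT i) r * a i * g i = r * \sum_(i | predT i) a i * g i.
    by rewrite mulr_sumr; apply: eq_bigr => i _; rewrite mulrA.
  by rewrite -mulrBr; exact: (idM Jid).
Qed.

Lemma in_ideal_mod_gen (I : finType) (g : I -> {mpoly K[n]}) i :
  in_ideal_mod J predT g (g i).
Proof.
exists (fun j => (j == i)%:R); rewrite (bigD1 i) //= eqxx mul1r big1 ?addr0 ?subrr.
  exact: (id0 Jid).
by move=> j /negbTE ->; rewrite mul0r.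
Qed.

End IdealMod.

(** * (I^e)_(ed+c) as the image of bidegree (c, e) *)

Section Rees.
Variables (K : fieldType) (n k : nat).
Local Notation P := {mpoly K[n]}.
Local Notation S := {mpoly P[k]}.
Variables (J : P -> Prop) (d : nat) (f : 'I_k -> P).
Hypothesis f_homog : forall i, f i \is d.-homog.
Hypothesis Jid : idealp J.
Hypothesis J_homog : homogeneous_ideal J.

Lemma pow_gens_homog e (s : {ffun 'I_e -> 'I_k}) : pow_gens f s \is (e * d).-homog.
Proof.
rewrite /pow_gens; elim: e s => [|e IH] s; first by rewrite big_ord0 mul0n dhomog1.
rewrite big_ord_recl mulSn; apply: dhomogM => //.
have := IH [ffun j => s (lift ord0 j)].
by congr (_ \is _); apply: eq_bigr => j _; rewrite ffunE.
Qed.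

Lemma eval_in_Ie c e (p : S) : bihom c e p -> in_Ie_t J f e (e * d + c) p.@[f].
Proof.
move=> hp; have hm m : m \in msupp p -> mdeg m = e by case: hp => [/dhomogP h _]; exact: h.
rewrite /in_Ie_t mevalE big_seq; split.
  apply: rpred_sum => m /hm /(mnm_prod_ffun f) [s ->].
  by rewrite addnC; apply: dhomogM; [exact: hp.2 | exact: pow_gens_homog].
have Iid := in_ideal_mod_idealp Jid (@pow_gens _ _ _ f e).
elim/big_ind: _ => [|x y|m /hm /(mnm_prod_ffun f) [s ->]].
- exact: (id0 Iid).
- exact: (idD Iid).
- by apply: (idM Iid); exact: in_ideal_mod_gen.
Qed.

Lemma prodX_bihom e (s : {ffun 'I_e -> 'I_k}) :
  bihom 0 e (\prod_(j < e) 'X_(s j) : S).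
Proof.
elim: e s => [|e IH] s.
  by rewrite big_ord0 -mpolyC1; apply: bihomC; exact: dhomog1.
have := bihomM (bihomX K n U_(s ord0)%MM) (IH [ffun j => s (lift ord0 j)]).
rewrite mdeg1 add0n add1n big_ord_recl; congr (bihom _ _ (_ * _)).
by apply: eq_bigr => j _; rewrite ffunE.
Qed.

Lemma eval_of_Ie c e (p : P) : in_Ie_t J f e (e * d + c) p ->
  exists2 q : S, bihom c e q & J (p - q.@[f]).
Proof.
move=> [hp [a ha]].
(* Each coefficient is cut down to its component of degree [c]; by homogeneity of [p], J and the
   generators, the congruence persists. *)
pose q : S := \sum_(s : {ffun 'I_e -> 'I_k})
  (pihomog mdeg c (a s))%:MP * \prod_(j < e) 'X_(s j).
exists q.
  rewrite /q; elim/big_ind: _ => [|x y|s _]; [exact: bihom0 | exact: bihomD |].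
  have := bihomM (bihomC k (pihomogP mdeg c (a s))) (prodX_bihom s).
  by rewrite addn0 add0n.
have -> : q.@[f] = pihomog mdeg (e * d + c) (\sum_(s | predT s) a s * pow_gens f s).
  rewrite /q !raddf_sum /=; apply: eq_bigr => s _.
  rewrite mevalM mevalC mulrC [a s * _]mulrC addnC pihomog_mulr; last exact: pow_gens_homog.
  congr (_ * _); rewrite rmorph_prod /=; apply: eq_bigr => j _.
  by rewrite mevalXU.
exact: homog_sub.
Qed.

End Rees.

Section Presentation.
Variables (K : fieldType) (n N w : nat) (J : {mpoly K[n]} -> Prop).
Variable (g : N.-tuple {mpoly K[n]}).
Hypothesis J_homog : homogeneous_ideal J.
Hypothesis w_gt0 : (0 < w)%N.
Hypothesis g_homog : forall i, tnth g i \is w.-homog.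

(** Substitution multiplies degrees by [w], and [w > 0] keeps distinct degrees distinct. *)
Lemma pihomog_comp t (q : {mpoly K[N]}) :
  pihomog mdeg (t * w) (q \mPo g) = (pihomog mdeg t q) \mPo g.
Proof.
rewrite comp_mpolyEX [pihomog mdeg t q]pihomogE !raddf_sum /= [RHS]big_mkcond /=.
apply: eq_bigr => m _; rewrite linearZ /=.
have hm : 'X_[m] \mPo g \is (mdeg m * w).-homog.
  rewrite comp_mpolyX mdegE big_distrl /=.
  elim/big_rec2: _ => [|i x y _ h]; first exact: dhomog1.
  by apply: dhomogM => //; rewrite mulnC; exact: dhomogMn.
case: eqP => [<-|ne].
  by rewrite pihomog_dE // comp_mpolyZ.
rewrite (pihomog_ne0 _ hm) ?scaler0 //.
by rewrite eqn_mul2r (gtn_eqF w_gt0) /=; apply/eqP.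
Qed.

Lemma ker_pres_homog t q : ker_pres J g q -> ker_pres J g (pihomog mdeg t q).
Proof. by rewrite /ker_pres -pihomog_comp => h; exact: J_homog. Qed.

End Presentation.

(** * Transfer of the resolution between the two presentations of R *)

Section Final.
Variables (K : fieldType) (n k : nat).
Local Notation P := {mpoly K[n]}.
Local Notation S := {mpoly P[k]}.
Variables (J : P -> Prop) (d : nat) (f : 'I_k -> P).
Hypothesis f_homog : forall i, f i \is d.-homog.
Hypothesis Jid : idealp J.
Hypothesis J_homog : homogeneous_ideal J.
Variables (c e N : nat) (g : N.-tuple P).
Hypothesis g_basis : is_basis_Iet J f e (e * d + c) g.
Hypothesis w_gt0 : (0 < e * d + c)%N.
Local Notation R := {mpoly K[N]}.
Local Notation dg := (@diag K n k c e).
Local Notation evR := (evJ J f).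
Let evid : idealp evR := evJ_idealp f Jid.
Let Ggr : grading dg := diag_grading K n k c e.

(** Links polynomials in N variables modulo [ker_pres J g] with the diagonal modulo [evJ J f]. It is
    a relation because lifts in either direction are determined only modulo these kernels. *)
Definition same_image (q : R) (p : S) := J ((q \mPo g) - p.@[f]).

Lemma same_image0 : same_image 0 0.
Proof. by rewrite /same_image comp_mpoly0 meval0 subrr; exact: (id0 Jid). Qed.

Lemma same_imageD q q' p p' :
  same_image q p -> same_image q' p' -> same_image (q + q') (p + p').
Proof.
by move=> h h'; rewrite /same_image comp_mpolyD mevalD opprD addrACA; exact: (idD Jid h h').
Qed.

Lemma same_imageB q q' p p' :
  same_image q p -> same_image q' p' -> same_image (q - q') (p - p').
Proof.
move=> h h'; rewrite /same_image comp_mpolyB mevalB.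
have -> : ((q \mPo g) - (q' \mPo g)) - (p.@[f] - p'.@[f]) =
  ((q \mPo g) - p.@[f]) - ((q' \mPo g) - p'.@[f]) by ring.
exact: (idB Jid h h').
Qed.

Lemma same_imageM q q' p p' :
  same_image q p -> same_image q' p' -> same_image (q * q') (p * p').
Proof.
move=> h h'; rewrite /same_image rmorphM /= mevalM.
have -> : (q \mPo g) * (q' \mPo g) - p.@[f] * p'.@[f] =
  (q' \mPo g) * ((q \mPo g) - p.@[f]) + p.@[f] * ((q' \mPo g) - p'.@[f]) by ring.
exact: (idD Jid (idM Jid _ h) (idM Jid _ h')).
Qed.

Lemma same_imageC (a : K) : same_image a%:MP a%:MP%:MP.
Proof. by rewrite /same_image comp_mpolyC mevalC subrr; exact: (id0 Jid). Qed.

Lemma same_image_ker q p : same_image q p -> (ker_pres J g q <-> evR p).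
Proof.
rewrite /same_image /ker_pres /evJ => h; split=> h'.
  by rewrite -[p.@[f]](subKr (q \mPo g)); exact: (idB Jid h' h).
by rewrite -[q \mPo g](subrK p.@[f]); exact: (idD Jid h h').
Qed.

Lemma same_image_mulmx r1 r2 r3 (A : 'M[R]_(r1, r2)) (B : 'M[R]_(r2, r3))
    (A' : 'M[S]_(r1, r2)) (B' : 'M[S]_(r2, r3)) :
  (forall a b, same_image (A a b) (A' a b)) ->
  (forall a b, same_image (B a b) (B' a b)) ->
  forall a b, same_image ((A *m B) a b) ((A' *m B') a b).
Proof.
move=> hA hB a b; rewrite !mxE.
elim/big_rec2: _ => [|j x y _ h]; first exact: same_image0.
exact: (same_imageD (same_imageM (hA _ _) (hB _ _)) h).
Qed.

Lemma gens_lift : exists h : 'I_N -> S,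
  forall i, dg 1 (h i) /\ same_image 'X_i (h i).
Proof.
apply: (@fin_all_exists _ (fun=> S) (fun i y => dg 1 y /\ same_image 'X_i y)) => i.
have [hg _ _] := g_basis.
have [q hq hJ] := eval_of_Ie f_homog J_homog (hg i).
exists q; split; first by rewrite /diag !muln1.
by rewrite /same_image comp_mpolyXU -tnth_nth.
Qed.

Lemma diag_expr m (x : S) : dg 1 x -> dg m (x ^+ m).
Proof.
move=> hx; elim: m => [|m IH]; first by rewrite expr0; exact: gr1.
by rewrite exprS -add1n; exact: (grM Ggr).
Qed.

Lemma homog_lift t (q : R) : q \is t.-homog -> exists2 p : S, dg t p & same_image q p.
Proof.
move=> /dhomogP hq; have [h hh] := gens_lift.
exists (\sum_(m <- msupp q) (q@_m)%:MP%:MP * \prod_i h i ^+ m i).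
  rewrite big_seq; elim/big_ind: _ => [|x y|m /hq hm].
  - exact: (gr0 Ggr).
  - exact: (grD Ggr).
  rewrite -[t]add0n; apply: (grM Ggr).
    rewrite /diag !muln0; apply: bihomC; exact: dhomogC0.
  rewrite -hm /= mdegE; elim/big_rec2: _ => [|i x y _ hx]; first exact: (gr1 Ggr).
  by apply: (grM Ggr) => //; apply: diag_expr; case: (hh i).
rewrite {1}[q]mpolyE; elim/big_rec2: _ => [|m x y _ hx]; first exact: same_image0.
apply: (same_imageD _ hx); rewrite -mul_mpolyC; apply: (same_imageM (same_imageC _)).
rewrite mpolyXE_id; elim/big_rec2: _ => [|i u v _ huv].
  by have := same_imageC 1; rewrite !mpolyC1.
apply: (same_imageM _ huv); elim: (m i) => [|j IH].
  by have := same_imageC 1; rewrite !mpolyC1 !expr0.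
by rewrite !exprS; exact: (same_imageM (hh i).2 IH).
Qed.

Lemma diag1_descend (p : S) : dg 1 p ->
  exists2 q : R, q \is 1.-homog & same_image q p.
Proof.
rewrite /diag !muln1 => hp; have [_ _ hg] := g_basis.
have [a ha] := hg _ (eval_in_Ie f_homog Jid hp).
exists (\sum_i a i *: 'X_i).
  by apply: rpred_sum => i _; apply: rpredZ; rewrite dhomogX /= mdeg1.
rewrite /same_image -opprB; apply: (idN Jid).
have -> // : (\sum_i a i *: 'X_i : R) \mPo g = \sum_i a i *: tnth g i.
rewrite raddf_sum; apply: eq_bigr => i _.
by rewrite /= comp_mpolyZ comp_mpolyXU -tnth_nth.
Qed.

Section Descent.
Variables (r : nat -> nat) (D0 : 'M[S]_(r 0%N, 1)).
Hypothesis D0_diag : forall a b, dg 1 (D0 a b).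
Hypothesis D0_gen : forall s p, dg s.+1 p -> exists2 v : 'rV[S]_(r 0%N),
  (forall j, dg s (v 0 j)) & evR (p - (v *m D0) 0 0).

(** Generation in degree 1 is read off from the first matrix of the resolution: [D0_gen] writes an
    element of degree [t + 1] through products with the entries of [D0], of degree 1. *)
Lemma diag_descend t : forall p : S, dg t p ->
  exists2 q : R, q \is t.-homog & same_image q p.
Proof.
elim: t => [|t IH] p hp.
  have [a ->] : exists a : K, p = a%:MP%:MP.
    by apply: bihom00; move: hp; rewrite /diag !muln0.
  by exists a%:MP; [exact: dhomogC0 | exact: same_imageC].
have [v hv hJ] := D0_gen hp.
have [q hq] : exists q : 'I_(r 0%N) -> R, forall j,
    q j \is t.-homog /\ same_image (q j) (v 0 j).
  apply: (@fin_all_exists _ (fun=> R) (fun j y => y \is t.-homog /\ same_image y (v 0 j))) => j.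
  by have [q] := IH _ (hv j); exists q.
have [x hx] : exists x : 'I_(r 0%N) -> R, forall j,
    x j \is 1.-homog /\ same_image (x j) (D0 j 0).
  apply: (@fin_all_exists _ (fun=> R) (fun j y => y \is 1.-homog /\ same_image y (D0 j 0))) => j.
  by have [q'] := diag1_descend (D0_diag j 0); exists q'.
exists (\sum_j q j * x j).
  by apply: rpred_sum => j _; rewrite -addn1; apply: dhomogM; [case: (hq j) | case: (hx j)].
have h : same_image (\sum_j q j * x j) ((v *m D0) 0 0).
  rewrite mxE; elim/big_rec2: _ => [|j a b _ hab]; first exact: same_image0.
  exact: (same_imageD (same_imageM (hq j).2 (hx j).2) hab).
rewrite -[p](subrK ((v *m D0) 0 0)) addrC -[\sum_j _]addr0.
apply: (same_imageD h); rewrite /same_image comp_mpoly0 sub0r.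
exact: (idN Jid hJ).
Qed.

Lemma row_descend t r1 (v : 'rV[S]_r1) : (forall j, dg t (v 0 j)) ->
  exists q : 'rV[R]_r1, forall j, same_image (q 0 j) (v 0 j).
Proof.
move=> hv; have [q hq] : exists q : 'I_r1 -> R, forall j, same_image (q j) (v 0 j).
  apply: (@fin_all_exists _ (fun=> R) (fun j y => same_image y (v 0 j))) => j.
  by have [q _ hq] := diag_descend (hv j); exists q.
by exists (\row_j q j) => j; rewrite mxE.
Qed.

Lemma row_lift t r1 (q : 'rV[R]_r1) : (forall j, q 0 j \is t.-homog) ->
  exists2 v : 'rV[S]_r1, (forall j, dg t (v 0 j)) &
    forall a b, same_image (q a b) (v a b).
Proof.
move=> hq; have [v hv] : exists v : 'I_r1 -> S, forall j,
    dg t (v j) /\ same_image (q 0 j) (v j).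
  apply: (@fin_all_exists _ (fun=> S) (fun j y => dg t y /\ same_image (q 0 j) y)) => j.
  by have [p] := homog_lift (hq j); exists p.
exists (\row_j v j) => [j|a b]; first by rewrite mxE; case: (hv j).
by rewrite (ord1 a) mxE; case: (hv b).
Qed.

Variable L : S -> R.
Hypothesis hL : forall p, dg 1 p -> L p \is 1.-homog /\ same_image (L p) p.

Lemma mx_L r1 r2 (D : 'M[S]_(r1, r2)) : (forall a b, dg 1 (D a b)) ->
  forall a b, same_image (map_mx L D a b) (D a b).
Proof. by move=> hD a b; rewrite mxE; case: (hL (hD a b)). Qed.

Lemma row_homog_sum r1 (v : 'rV[R]_r1) :
  exists T, v = \sum_(t < T) map_mx (pihomog mdeg t) v.
Proof.
pose F (j : 'I_r1) := mmeasure mdeg (v 0%R j).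
exists (\max_j F j); apply/rowP => j.
rewrite summxE [LHS](pihomog_partitionE (leq_bigmax (F := F) j)).
by apply: eq_bigr => t _; rewrite mxE.
Qed.

Local Notation kp := (ker_pres J g).

Lemma ker_pres_idealp : idealp kp.
Proof.
split; rewrite /ker_pres.
- by rewrite comp_mpoly0; exact: (id0 Jid).
- by move=> p q hp hq; rewrite comp_mpolyD; exact: (idD Jid).
- by move=> p q hq; rewrite rmorphM; exact: (idM Jid).
Qed.

Let kid := ker_pres_idealp.

Lemma g_homog i : tnth g i \is (e * d + c).-homog.
Proof. by have [/(_ i) []] := g_basis. Qed.

(** [koszul] quantifies over all polynomials, homogeneous or not, so each component is treated
    separately and the preimages are added. *)
Lemma descend_generate (p : R) : mcoeff 0%MM p = 0 ->
  exists v : 'rV[R]_(r 0%N), kp (p - (v *m map_mx L D0) 0 0).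
Proof.
move=> p0.
have H t : exists v : 'rV[R]_(r 0%N), kp (pihomog mdeg t p - (v *m map_mx L D0) 0 0).
  case: t => [|t].
    exists 0; rewrite mul0mx mxE subr0.
    have -> : pihomog mdeg 0 p = 0; last exact: (id0 kid).
    apply/mpolyP => m; rewrite mcoeff_pihomog mcoeff0 mdeg_eq0.
    by case: eqP => // ->.
  have [p' hp' hpp] := homog_lift (pihomogP mdeg t.+1 p).
  have [v' hv' hJ] := D0_gen hp'.
  have [v hv] := row_descend hv'.
  exists v; apply: (proj2 (same_image_ker _) hJ).
  apply: (same_imageB hpp); apply: same_image_mulmx (mx_L D0_diag) _ _ => a b.
  by rewrite (ord1 a); exact: hv.
have [F hF] : exists F : nat -> 'rV[R]_(r 0%N), forall t,
    kp (pihomog mdeg t p - (F t *m map_mx L D0) 0 0).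
  exists (fun t => proj1_sig (constructive_indefinite_description _ (H t))) => t.
  exact: (proj2_sig (constructive_indefinite_description _ (H t))).
exists (\sum_(t < mmeasure mdeg p) F t).
rewrite [p in kp (p - _)](@pihomog_partitionE _ _ mdeg (mmeasure mdeg p)) //.
rewrite mulmx_suml summxE -sumrB.
by elim/big_ind: _ => [|x y|t _]; [exact: (id0 kid) | exact: (idD kid) |].
Qed.

Lemma descend_exact r1 r2 r3 (D : 'M[S]_(r1, r2)) (D' : 'M[S]_(r3, r1)) 
    (v : 'rV[R]_r1) :
  good_mx dg evR D -> next_mx dg evR D D' ->
  (forall j, kp ((v *m map_mx L D) 0 j)) ->
  exists w : 'rV[R]_r3, forall j, kp ((v - w *m map_mx L D') 0 j).
Proof.
move=> [gD iD _] [[gD' _ _] _ exD] hv.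
have L1 a b : map_mx L D a b \is 1.-homog by rewrite mxE; case: (hL (gD a b)).
have H t : exists w : 'rV[R]_r3,
    forall j, kp ((map_mx (pihomog mdeg t) v - w *m map_mx L D') 0 j).
  have hvt j : map_mx (pihomog mdeg t) v 0 j \is t.-homog by rewrite mxE; exact: pihomogP.
  have [x hx hxv] := row_lift hvt.
  have hxD : entries evR (x *m D).
    move=> b; apply/(same_image_ker (same_image_mulmx hxv (mx_L gD) 0 b)).
    rewrite -pihomog_row_mul //; exact: (ker_pres_homog J_homog w_gt0 g_homog).
  (* Degree 0 rests on the injectivity clause of [good_mx], positive degrees on the exactness clause
     of [next_mx]. *)
  case: t hvt x hx hxv hxD => [|t] hvt x hx hxv hxD.
    exists 0 => j; rewrite mul0mx subr0; apply/(same_image_ker (hxv 0 j)).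
    exact: iD.
  have [y hy hJ] := exD t x (conj hx hxD).
  have [w hw] := row_descend hy.
  exists w => j; have := hJ j; rewrite !subrowE => {}hJ; apply: (proj2 (same_image_ker _) hJ).
  apply: (same_imageB (hxv _ _)); apply: same_image_mulmx (mx_L gD') _ _ => a b.
  by rewrite (ord1 a); exact: hw.
have [F hF] : exists F : nat -> 'rV[R]_r3, forall t,
    forall j, kp ((map_mx (pihomog mdeg t) v - F t *m map_mx L D') 0 j).
  exists (fun t => proj1_sig (constructive_indefinite_description _ (H t))) => t.
  exact: (proj2_sig (constructive_indefinite_description _ (H t))).
have [T hT] := row_homog_sum v.
exists (\sum_(t < T) F t) => j; rewrite [in v - _]hT mulmx_suml -sumrB summxE.
by elim/big_ind: _ => [|x y|t _]; [exact: (id0 kid) | exact: (idD kid) | exact: hF].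
Qed.

End Descent.

End Final.

(** In degree 0 the first form is a constant: zero contradicts regularity since A is not the zero
    ring, and a unit contradicts properness of the ideal of the [f_i]. *)
Lemma regular_degree_gt0 (K : fieldType) (n k d : nat) (J : {mpoly K[n]} -> Prop)
    (f : 'I_k -> {mpoly K[n]}) :
  std_graded J -> (0 < k)%N -> (forall i, f i \is d.-homog) -> regular_seq J f ->
  (0 < d)%N.
Proof.
move=> [[J0 _ _] _ J1] k_gt0 hf [reg reg1]; rewrite lt0n; apply/eqP => d0.
pose i0 : 'I_k := Ordinal k_gt0.
have [a ha] : exists a : K, f i0 = a%:MP.
  exists (f i0)@_0; apply/mpolyP => m; have := hf i0; rewrite d0 => h.
  rewrite -{1}(pihomog_dE h) mcoeff_pihomog mcoeffC mdeg_eq0.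
  by case: eqP => [->|]; rewrite ?mulr1 ?mulr0.
have [a0|a_neq0] := eqVneq a 0.
  have /reg [b] : in_ideal_mod J (fun j : 'I_k => (j < i0)%N) f (f i0 * 1).
    by exists (fun=> 0); rewrite big_pred0 // subr0 ha a0 mpolyC0 mul0r.
  by rewrite big_pred0 // subr0.
apply: reg1; exists (fun i => if i == i0 then (a^-1)%:MP else 0).
rewrite (bigD1 i0) //= ?eqxx big1 => [|i /negbTE ->]; last by rewrite mul0r.
by rewrite addr0 ha -mpolyCM mulVf // mpolyC1 subrr.
Qed.

Theorem theorem4p5 (K : fieldType) (n : nat) (J : {mpoly K[n]} -> Prop)
  (k d : nat) (f : 'I_k -> {mpoly K[n]}) :
  std_graded J -> koszul J ->
  (0 < k)%N ->
  (forall i, f i \is d.-homog) ->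
  regular_seq J f ->
  forall c e : nat, (d * (k - 1) <= c * k)%N -> (0 < e)%N ->
  forall (N : nat) (g : N.-tuple {mpoly K[n]}),
    is_basis_Iet J f e (e * d + c) g ->
    koszul (ker_pres J g).
Proof.
move=> Jstd Jkos k_gt0 f_homog f_reg c e hc e_gt0 N g g_basis.
have d_gt0 := regular_degree_gt0 Jstd k_gt0 f_homog f_reg.
have w_gt0 : (0 < e * d + c)%N by rewrite addn_gt0 muln_gt0 e_gt0 d_gt0.
have [[J0 JD JM] J_homog _] := Jstd.
have Jid : idealp J by split.
have evid := evJ_idealp f Jid.
have LR t m : (0 < t)%N -> Lin (diag c e) (evJ J f) m
    (fun s => diag (K := K) (n := n) (k := k) c e (t + s) : _^o -> Prop) (fun _ => evJ J f).
  by move=> ht; exact: (Lin_rees f_homog Jid J_homog f_reg Jkos e_gt0 k_gt0 hc).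
have Gfield (q : {mpoly {mpoly K[n]}[k]}) : diag c e 0 q ->
    evJ J f q \/ exists2 q', diag c e 0 q' & q' * q = 1.
  rewrite /diag !muln0 => /bihom00 [a ->].
  have [->|a0] := eqVneq a 0; first by left; rewrite !mpolyC0; exact: (id0 evid).
  right; exists (a^-1)%:MP%:MP; first by apply: bihomC; exact: dhomogC0.
  by rewrite -!mpolyCM mulVf // !mpolyC1.
(* Degree 1 gives the maximal ideal of R, which is to be resolved; degree 2 serves to change
   generating sets. *)
have [r [D0 [Dn [good0 gen0 next0 nextn]]]] := linear_resolution (diag_grading K n k c e)
  evid (fun i => LR 1%N i isT) (fun i => LR 2%N i isT) Gfield.
have D0_diag : forall a b, diag c e 1 (D0 a b) by case: good0.
have Dn_good i : good_mx (diag c e) (evJ J f) (Dn i).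
  by case: i => [|i]; [case: next0 | case: (nextn i)].
have Dn_diag i a b : diag c e 1 (Dn i a b) by case: (Dn_good i).
(* One fixed choice of linear forms, unconstrained outside degree 1, translates all matrices
   entrywise. *)
have [L hL] : exists L : {mpoly {mpoly K[n]}[k]} -> {mpoly K[N]},
    forall p, diag c e 1 p -> L p \is 1.-homog /\ same_image J f g (L p) p.
  have H p : exists q, diag c e 1 p -> q \is 1.-homog /\ same_image J f g q p.
    have [h|h] := classic (diag c e 1 p); last by exists 0.
    by have [q hq hqp] := diag1_descend f_homog Jid g_basis h; exists q.
  exists (fun p => proj1_sig (constructive_indefinite_description _ (H p))) => p.
  exact: (proj2_sig (constructive_indefinite_description _ (H p))).
have ker_mul r1 r2 r3 (A : 'M_(r1, r2)) (B : 'M_(r2, r3)) :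
    (forall a b, diag c e 1 (A a b)) -> (forall a b, diag c e 1 (B a b)) ->
    (forall a b, evJ J f ((A *m B) a b)) ->
    forall a b, ker_pres J g ((map_mx L A *m map_mx L B) a b).
  move=> hA hB hAB a b.
  by apply/(same_image_ker Jid (same_image_mulmx Jid (mx_L hL hA) (mx_L hL hB) a b)).
exists r, (map_mx L D0), (fun i => map_mx L (Dn i)).
split; first by move=> a b; rewrite mxE; case: (hL _ (D0_diag a b)).
split; first by move=> i a b; rewrite mxE; case: (hL _ (Dn_diag i a b)).
split; first by apply: ker_mul => //; case: next0.
split; first by move=> i; apply: ker_mul => //; case: (nextn i).
split; first exact: (descend_generate f_homog Jid J_homog g_basis D0_diag gen0 hL).
have exact1 := descend_exact f_homog Jid J_homog g_basis w_gt0 D0_diag gen0 hL.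
split=> [v hv|i v hv]; last exact: exact1 (nextn i) hv.
by apply: exact1 next0 _ => // j; rewrite (ord1 j).
Qed.
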